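(* Let $\alpha\ge0$, let $\beta(\alpha)>0$ and $h_1$ be as defined in the context, and set $\gamma(s):=\beta(\alpha)\sqrt{1-s}$ for $s\in[0,1]$. For $t\in[0,1)$ and $x\in\mathbb{R}$ let $\{X_s\}_{s\in[t,1]}$ be the process $$dX_s=-\frac{1+\alpha^2}{2}\,\frac{X_s}{1-s}\,ds+dB_s,\quad s\in[t,1),\qquad X_t=x,$$ with $X_1=0$. Then the optimal stopping problem $V(x,t):=\sup_\tau\mathbb{E}[X_\tau\mid X_t=x]$, with supremum over all stopping times $\tau$ with values in $[t,1]$, is solved by $$\tau^*=\inf\{s\in[t,1]:X_s\ge\gamma(s)\},$$ that is, $V(x,t)=\mathbb{E}[X_{\tau^*}\mid X_t=x]$, and $$V(x,t)=\begin{cases}h_1\!\left(-\alpha\beta(\alpha)\dfrac{x}{\gamma(t)}\right)\dfrac{\gamma(t)}{h_1(-\alpha\beta(\alpha))}, & x<\gamma(t),\\[2mm] x, & x\ge\gamma(t),\end{cases}$$ where, for $\alpha=0$, the quotient $h_1(-\alpha\beta(\alpha)y)/h_1(-\alpha\beta(\alpha))$ is to be read as $e^{y-1}$.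
   Context: $\{B_s\}$ is a standard Brownian motion and stopping times are with respect to its filtration. The value $X_1=0$ is the almost sure limit of $X_s$ as $s\to1^-$. For $\alpha>0$ put $\xi:=1/(2\alpha^2)$ and $$h_1(z):=\frac{\sqrt{\pi}}{2^{\xi}}\left[\frac{1}{\Gamma(\frac12+\xi)}M\!\left(\xi,\tfrac12,\tfrac12z^2\right)-\frac{z\sqrt2}{\Gamma(\xi)}M\!\left(\xi+\tfrac12,\tfrac32,\tfrac12z^2\right)\right],\quad z\in\mathbb{R},$$ where $M(a,c,w)=\sum_{n\ge0}\frac{(a)_n}{(c)_n}\frac{w^n}{n!}$ is Kummer's confluent hypergeometric function and $\Gamma$ is the gamma function. ($h_1$ depends on $\alpha$ through $\xi$.) For $\alpha>0$, there is a unique $x_\alpha<0$ with $x_\alpha h_1'(x_\alpha)=h_1(x_\alpha)$, and $\beta(\alpha):=-x_\alpha/\alpha>0$. For $\alpha=0$, $\beta(0):=1$. *)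

(* Defs.v *)
From HB Require Import structures.
From mathcomp Require Import all_boot all_order all_algebra.
From mathcomp Require Import all_classical all_reals all_analysis.

Set Implicit Arguments.
Unset Strict Implicit.
Unset Printing Implicit Defensive.

Import Order.TTheory GRing.Theory Num.Theory.
Import numFieldNormedType.Exports.

Local Open Scope classical_set_scope.
Local Open Scope ring_scope.

Section special_functions.
Context {R : realType}.

(* Euler's integral; the real-valued integral is meaningful for 0 < a only. *)
Definition Gamma (a : R) : R :=
  \int[@lebesgue_measure R]_(u in `]0, +oo[) (u `^ (a - 1) * expR (- u)).

Definition pochhammer (a : R) (n : nat) : R := \prod_(i < n) (a + i%:R).

Definition kummerM (a c w : R) : R :=
  limn (series (fun n : nat =>
    pochhammer a n / pochhammer c n * (w ^+ n / n`!%:R))).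

Definition xi (alpha : R) : R := (2 * alpha ^+ 2)^-1.

(* For 0 < alpha. *)
Definition h1 (alpha z : R) : R :=
  Num.sqrt pi / 2 `^ xi alpha *
  ((Gamma (2^-1 + xi alpha))^-1 * kummerM (xi alpha) 2^-1 (2^-1 * z ^+ 2)
   - z * Num.sqrt 2 / Gamma (xi alpha)
     * kummerM (xi alpha + 2^-1) (3 / 2) (2^-1 * z ^+ 2)).

(* The negative solution of z h1'(z) = h1(z), for 0 < alpha. The default value
   0 is used only if there is no such solution. *)
Definition x_root (alpha : R) : R :=
  xget 0 [set z : R | z < 0 /\ z * derive1 (h1 alpha) z = h1 alpha z].

Definition beta (alpha : R) : R :=
  if alpha == 0 then 1 else - x_root alpha / alpha.

Definition gamma (alpha s : R) : R := beta alpha * Num.sqrt (1 - s).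

(* h1(- alpha beta y) / h1(- alpha beta), read as exp(y - 1) if alpha = 0 *)
Definition h1_quotient (alpha y : R) : R :=
  if alpha == 0 then expR (y - 1)
  else h1 alpha (- alpha * beta alpha * y) / h1 alpha (- alpha * beta alpha).

End special_functions.

Section processes.
Context d (T : measurableType d) (R : realType) (P : probability T R).
Implicit Types B X : R -> T -> R.

(* Processes are indexed by all of R, but only the values B s with 0 <= s and
   X s with t <= s <= 1 matter. *)

(* the sigma-algebra generated by the B u with 0 <= u <= s, not completed *)
Definition natural_filtration B (s : R) : set (set T) :=
  <<s \bigcup_(u in `[0, s]) preimage_set_system setT (B u) measurable >>.

(* The second parameter of normal_prob is the standard deviation. *)
Definition standard_brownian_motion B : Prop :=
  [/\ forall s : R, 0 <= s -> measurable_fun setT (B s),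
      {ae P, forall w, B 0 w = 0},
      forall w, {within `[0, +oo[, continuous (fun s => B s w)},
      forall u s : R, 0 <= u -> u < s -> forall C : set R, measurable C ->
        P ((B s \- B u) @^-1` C)
        = normal_prob 0 (Num.sqrt (s - u)) C
    & forall u s : R, 0 <= u -> u < s ->
        forall A, natural_filtration B u A -> forall C : set R, measurable C ->
        P (A `&` (B s \- B u) @^-1` C)
        = (P A * P ((B s \- B u)%R @^-1` C))%E].

(* Strong solution on [t, 1[, extended by 0 at time 1. As the noise is
   additive, the stochastic differential equation is an integral equation along
   the paths; at s = t it says that X t = x almost surely. *)
Definition sde_solution (alpha : R) B (t x : R) X : Prop :=
  [/\ forall s : R, t <= s < 1 -> forall C : set R, measurable C ->
        natural_filtration B s (X s @^-1` C),
      forall w, {within `[t, 1[, continuous (fun s => X s w)},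
      {ae P, forall w, forall s : R, t <= s < 1 ->
        X s w = x
          + \int[@lebesgue_measure R]_(u in `[t, s])
              (- ((1 + alpha ^+ 2) / 2) * (X u w / (1 - u)))
          + (B s w - B t w)}
    & forall w, X 1 w = 0].

Definition stopping_time B (t : R) (tau : T -> R) : Prop :=
  (forall w, t <= tau w <= 1) /\
  (forall s : R, 0 <= s -> natural_filtration B s [set w | tau w <= s]).

(* X starts from a deterministic point at time t, so that the conditional
   expectation given the starting point is the plain expectation. *)
Definition stopped_mean X (tau : T -> R) : \bar R :=
  'E_P[fun w => X (tau w) w]%E.

Definition stopping_value B X (t : R) : \bar R :=
  ereal_sup [set stopped_mean X tau | tau in stopping_time B t].

Definition hitting_time (alpha : R) X (t : R) (w : T) : R :=
  inf [set s : R | t <= s <= 1 /\ gamma alpha s <= X s w].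

End processes.

(* Main.v *)
Require Import Defs.
From HB Require Import structures.
From mathcomp Require Import all_boot all_order all_algebra.
From mathcomp Require Import all_classical all_reals all_analysis.
From mathcomp Require Import measurable_realfun ring lra.

(** Multiplied by [(1 - s) ^ (- (1 + alpha^2) / 2)], the process [X] becomes
    [Y], the Wiener integral of a deterministic function, with quadratic
    variation [A]. Hence [exp (l Y - l^2 A / 2)] is a martingale for every [l],
    which can be seen without stochastic integration by telescoping over finer
    and finer grids. For [0 < alpha] the gamma integral turns [h1] into a
    mixture of exponentials in which the claimed value becomes a positive
    mixture of these martingales; for [alpha = 0] one of them is enough. The
    equation defining [beta] says that the value, as a convex function of [x],
    is tangent to the identity, so the value dominates the gain and optional
    stopping bounds the expected gain by the value. Stopped when [gamma] is
    reached, the martingales are bounded and the gain equals the value, which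
    gives equality. To start above [gamma], compare with the bridge started on
    [gamma]. *)

Set Implicit Arguments.
Unset Strict Implicit.
Unset Printing Implicit Defensive.

Import Order.TTheory GRing.Theory Num.Theory.
Import numFieldNormedType.Exports.

Local Open Scope classical_set_scope.
Local Open Scope ring_scope.

(** * Exponential martingales along a grid *)

Section independent_product.
Local Open Scope ereal_scope.
Context d1 d2 d3 (T : measurableType d1) (U : measurableType d2)
  (V : measurableType d3) (R : realType) (P : probability T R)
  (Q : probability V R).

Lemma ge0_integral_indep (Z : T -> U) (W : T -> V) (f : U -> \bar R)
    (g : V -> \bar R) :
  measurable_fun setT Z -> measurable_fun setT W ->
  measurable_fun setT f -> measurable_fun setT g ->
  (forall u, 0 <= f u) -> (forall v, 0 <= g v) ->
  (forall A C, measurable A -> measurable C ->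
    P (Z @^-1` A `&` W @^-1` C) = P (Z @^-1` A) * Q C) ->
  \int[P]_w (f (Z w) * g (W w)) = (\int[P]_w f (Z w)) * \int[Q]_v g v.
Proof.
move=> mZ mW mf mg f0 g0 indep.
pose Zm : {mfun T >-> U} := HB.pack Z (isMeasurableFun.Build _ _ _ _ Z mZ).
have mZW : measurable_fun setT (fun w => (Z w, W w)).
  exact: measurable_fun_pair.
pose ZW : {mfun T >-> (U * V)%type} :=
  HB.pack (fun w => (Z w, W w)) (isMeasurableFun.Build _ _ _ _ _ mZW).
pose h (z : U * V) := f z.1 * g z.2.
have mh : measurable_fun setT h.
  apply: emeasurable_funM.
    exact: measurableT_comp mf measurable_fst.
  exact: measurableT_comp mg measurable_snd.
have h0 z : 0 <= h z by rewrite /h mule_ge0.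
transitivity (\int[distribution P ZW]_z h z).
  by rewrite ge0_integral_distribution.
transitivity (\int[distribution P Zm \x Q]_z h z).
  apply: eq_measure_integral => A mA _; apply/esym.
  exact: product_measure_unique.
rewrite fubini_tonelli1// /fubini_F /h/=.
under eq_integral do rewrite ge0_integralZl//.
rewrite ge0_integralZr//; last exact: integral_ge0.
by rewrite ge0_integral_distribution.
Qed.

End independent_product.

Section normal_moment.
Import HBNNSimple.
Context {R : realType}.
Implicit Types (l m s : R).

Let nnsfun_normal_prob m s (f : {nnsfun measurableTypeR R >-> R}) :
  (\int[normal_prob m s]_x (f x)%:E =
   \int[lebesgue_measure]_x (f x * normal_pdf m s x)%:E)%E.
Proof.
have mpdf r : measurable_fun [set: measurableTypeR R] (fun x =>
    (r * \1_(f @^-1` [set r]) x * normal_pdf m s x)%:E).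
  apply/measurable_EFinP; apply: measurable_funM.
    exact: measurable_funM.
  exact: measurable_normal_pdf.
have mind r : measurable_fun [set: measurableTypeR R] (fun x => (r * \1_(f @^-1` [set r]) x)%:E).
  by apply/measurable_EFinP; exact: measurable_funM.
transitivity (\sum_(r \in range f) (r%:E * normal_prob m s (f @^-1` [set r])))%E.
  under eq_integral do rewrite fimfunE -fsumEFin//.
  rewrite ge0_integral_fsum//; last first.
    by move=> y x _; rewrite nnfun_muleindic_ge0.
  apply: eq_fsbigr => r _; rewrite integralZl_indic_nnsfun//.
  by rewrite integral_indic// setIT.
under [RHS]eq_integral => x _.
  rewrite fimfunE (_ : _ * _ = \sum_(r \in range f)
    (r * \1_(f @^-1` [set r]) x * normal_pdf m s x)); last first.
    by rewrite mulrC mulr_fsumr; apply: eq_fsbigr => r _; rewrite mulrC.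
  rewrite -fsumEFin//; over.
rewrite ge0_integral_fsum//; last first.
  move=> r x _; rewrite EFinM mule_ge0 ?lee_fin ?normal_pdf_ge0//.
  by have := nnfun_muleindic_ge0 f r x.
apply: eq_fsbigr => r; rewrite inE => -[x0 _ <-].
under eq_integral do rewrite -mulrA EFinM.
rewrite ge0_integralZl_EFin//; last 2 first.
  by move=> x _; rewrite lee_fin mulr_ge0// normal_pdf_ge0.
  apply/measurable_EFinP; apply: measurable_funM => //.
  exact: measurable_normal_pdf.
congr (_ * _)%E; rewrite /normal_prob [LHS]integral_mkcond.
apply: eq_integral => x _.
by rewrite patchE indicE; case: ifP => _; rewrite ?mul1r ?mul0r.
Qed.

Lemma ge0_integral_normal_prob m s (g : R -> R) :
  measurable_fun setT g -> (forall x, 0 <= g x) ->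
  (\int[normal_prob m s]_x (g x)%:E =
   \int[lebesgue_measure]_x (g x * normal_pdf m s x)%:E)%E.
Proof.
move=> mg g0.
have meg : measurable_fun [set: measurableTypeR R] (EFin \o g).
  exact/measurable_EFinP.
pose f := nnsfun_approx measurableT meg.
have fg x : f n x @[n --> \oo] --> g x.
  have /fine_cvgP[_] : ((EFin \o f n) x @[n --> \oo] --> (g x)%:E)%E.
    by apply: cvg_nnsfun_approx => // y _; rewrite lee_fin.
  by [].
have ndf x : nondecreasing_seq (f ^~ x).
  by move=> a b ab; exact/lefP/nd_nnsfun_approx.
have L1 : (\int[normal_prob m s]_x (f n x)%:E)%E @[n --> \oo] -->
    (\int[normal_prob m s]_x (g x)%:E)%E.
  have -> : (\int[normal_prob m s]_x (g x)%:E)%E =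
    (\int[normal_prob m s]_x limn (fun n => (f n x)%:E))%E.
    by apply: eq_integral => x _; apply/esym/cvg_lim => //; apply: cvg_EFin;
      [exact: nearW | exact: fg].
  apply: cvg_monotone_convergence => //.
  - by move=> n; exact/measurable_EFinP.
  - by move=> n x _; rewrite lee_fin.
  - by move=> x _ a b ab; rewrite lee_fin; exact: ndf.
have L2 : (\int[lebesgue_measure]_x (f n x * normal_pdf m s x)%:E)%E @[n --> \oo] -->
    (\int[lebesgue_measure]_x (g x * normal_pdf m s x)%:E)%E.
  have -> : (\int[lebesgue_measure]_x (g x * normal_pdf m s x)%:E)%E =
    (\int[lebesgue_measure]_x limn (fun n => (f n x * normal_pdf m s x)%:E))%E.
    apply: eq_integral => x _; apply/esym/cvg_lim => //; apply: cvg_EFin;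
      [exact: nearW |].
    by apply: cvgM; [exact: fg | exact: cvg_cst].
  apply: cvg_monotone_convergence => //.
  - move=> n; apply/measurable_EFinP; apply: measurable_funM => //.
    exact: measurable_normal_pdf.
  - by move=> n x _; rewrite lee_fin mulr_ge0// normal_pdf_ge0.
  - move=> x _ a b ab; rewrite lee_fin ler_wpM2r ?normal_pdf_ge0//.
    exact: ndf.
apply: (cvg_unique _ L1) => //=.
by under eq_fun do rewrite nnsfun_normal_prob.
Qed.

Lemma integral_expR_normal_prob l s : s != 0 ->
  (\int[normal_prob 0 s]_x (expR (l * x))%:E = (expR (l ^+ 2 * s ^+ 2 / 2))%:E)%E.
Proof.
move=> s0; rewrite ge0_integral_normal_prob//; last first.
  by apply: measurableT_comp => //; exact: measurable_funM.
transitivity (\int[lebesgue_measure]_x ((expR (l ^+ 2 * s ^+ 2 / 2))%:E *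
    (normal_pdf (l * s ^+ 2) s x)%:E))%E.
  apply: eq_integral => x _; rewrite -EFinM; congr EFin.
  rewrite !normal_pdfE// mulrCA [RHS]mulrCA.
  congr (_ * _); rewrite /normal_fun -!expRD; congr expR.
  by field.
rewrite ge0_integralZl_EFin ?expR_ge0//.
- by rewrite integral_normal_pdf mule1.
- by move=> x _; rewrite lee_fin normal_pdf_ge0.
- by apply/measurable_EFinP; exact: measurable_normal_pdf.
Qed.

End normal_moment.

Section adapted.
Context d (T : measurableType d) (R : realType) (B : R -> T -> R).

Definition adapted_at (s : R) (Z : T -> R) :=
  forall C : set R, measurable C -> natural_filtration B s (Z @^-1` C).

Definition filtration_generator (s : R) : set (set T) :=
  \bigcup_(u in `[0, s]) preimage_set_system setT (B u) measurable.

Lemma adapted_atP s Z : adapted_at s Z <->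
  measurable_fun [set: g_sigma_algebraType (filtration_generator s)] Z.
Proof.
split=> [aZ _ C mC|mZ C mC]; first by rewrite setTI; exact: aZ.
by have := mZ measurableT C mC; rewrite setTI.
Qed.

Lemma natural_filtration_le r s A : r <= s ->
  natural_filtration B r A -> natural_filtration B s A.
Proof.
move=> rs; apply: sub_sigma_algebra2 => C [u /=]; rewrite in_itv/= => /andP[u0 ur] [D mD <-].
by exists u => /=; [rewrite in_itv/= u0 (le_trans ur rs) | exists D].
Qed.

Lemma adapted_at_le r s Z : r <= s -> adapted_at r Z -> adapted_at s Z.
Proof. by move=> rs aZ C mC; apply: natural_filtration_le rs _; exact: aZ. Qed.

Lemma adapted_at_process u s : 0 <= u <= s -> adapted_at s (B u).
Proof.
move=> us C mC; apply: sub_sigma_algebra; exists u => /=; first by rewrite in_itv.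
by exists C => //; rewrite setTI.
Qed.

Context (mB : forall s, 0 <= s -> measurable_fun setT (B s)).

Lemma natural_filtration_measurable s A :
  natural_filtration B s A -> measurable A.
Proof.
move: A; apply: smallest_sub; first exact: sigma_algebra_measurable.
move=> C [u /=]; rewrite in_itv/= => /andP[u0 _] [D mD <-].
exact: mB.
Qed.

Lemma adapted_at_measurable s Z : adapted_at s Z -> measurable_fun setT Z.
Proof.
move=> aZ _ C mC; rewrite setTI.
by apply: natural_filtration_measurable; exact: aZ.
Qed.

Lemma stopping_time_measurable t tau : 0 <= t ->
  stopping_time B t tau -> measurable_fun setT tau.
Proof.
move=> t0 [tau01 stau]; apply: (measurability _ (RGenOInfty.measurableE R)).
move=> _ [_ [r ->] <-]; rewrite setTI.
rewrite (_ : _ @^-1` _ = ~` [set w | tau w <= r]); last first.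
  by apply/seteqP; split=> w /=; rewrite in_itv/= andbT ltNge => /negP.
apply: measurableC; have [r0|r0] := leP 0 r.
  by apply: natural_filtration_measurable; exact: stau.
rewrite (_ : [set _ | _] = set0)//; apply/seteqP; split=> w//=.
by have /andP[tw _] := tau01 w; rewrite leNgt (lt_le_trans r0 (le_trans t0 tw)).
Qed.

End adapted.

Section exponential_martingale.
Context d (T : measurableType d) (R : realType) (P : probability T R).
Context (B : R -> T -> R) (hB : standard_brownian_motion P B).

Lemma brownian_measurable s : 0 <= s -> measurable_fun setT (B s).
Proof. by case: hB => + _ _ _ _; exact. Qed.

Lemma integral_adapted_expR_increment (l u s : R) (Z : T -> R) :
  0 <= u -> u < s -> adapted_at B u Z -> (forall w, 0 <= Z w) ->
  (\int[P]_w (Z w * expR (l * (B s w - B u w) - l ^+ 2 * (s - u) / 2))%:E =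
   \int[P]_w (Z w)%:E)%E.
Proof.
move=> u0 us aZ Z0; have s0 : 0 <= s by rewrite (le_trans u0)// ltW.
have [mB _ _ BN BI] := hB.
have mZ := adapted_at_measurable mB aZ.
have mdB : measurable_fun setT (B s \- B u).
  by apply: measurable_funB; exact: mB.
pose c := expR (- (l ^+ 2 * (s - u) / 2)).
have c0 : 0 <= c by exact: expR_ge0.
pose f (r : R) : \bar R := (Num.max r 0)%:E.
pose g (r : R) : \bar R := (expR (l * r))%:E.
have mg : measurable_fun setT g.
  by apply/measurable_EFinP; apply: measurableT_comp => //; exact: measurable_funM.
have mf : measurable_fun setT f.
  by apply/measurable_EFinP; exact: measurable_maxr.
have su : Num.sqrt (s - u) != 0 by rewrite gt_eqF// sqrtr_gt0 subr_gt0.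
have := @ge0_integral_indep _ _ _ _ _ _ _ P (normal_prob 0 (Num.sqrt (s - u)))
  Z (B s \- B u) f g mZ mdB mf mg.
have -> : (\int[normal_prob 0 (Num.sqrt (s - u))]_v g v = (c^-1)%:E)%E.
  rewrite integral_expR_normal_prob// sqr_sqrtr ?subr_ge0 ?ltW//.
  by rewrite /c expRN invrK.
have fZ w : f (Z w) = (Z w)%:E by rewrite /f max_l.
under [in X in _ -> _ -> _ -> _ = X]eq_integral do rewrite fZ.
move=> H; transitivity (c%:E * \int[P]_w (f (Z w) * g ((B s \- B u)%R w)))%E.
  rewrite -ge0_integralZl_EFin//.
  - apply: eq_integral => w _; rewrite fZ -!EFinM; congr EFin.
    by rewrite /c expRD /= mulrA mulrC.
  - by move=> w _; rewrite mule_ge0// lee_fin ?expR_ge0// le_max lexx orbT.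
  - by apply: emeasurable_funM; exact: measurableT_comp.
rewrite H.
- by rewrite muleC -muleA -EFinM mulVf ?mule1// gt_eqF// expR_gt0.
- by move=> r; rewrite lee_fin le_max lexx orbT.
- by move=> r; rewrite lee_fin expR_ge0.
- move=> A C mA mC; rewrite BI//; first by congr (_ * _)%E; exact: BN.
  exact: aZ.
Qed.

Context (t : R) (tau : T -> R) (stau : stopping_time B t tau).
Context (s : nat -> R) (s0 : 0 <= s 0%N) (s_incr : forall n, s n < s n.+1).
Implicit Types a : nat -> R.

Definition stopped_log a k w := \sum_(j < k)
  (if tau w <= s j then 0 else
   a j * (B (s j.+1) w - B (s j) w) - a j ^+ 2 * (s j.+1 - s j) / 2).

Let s_ge0 n : 0 <= s n.
Proof. by elim: n => // n ih; rewrite (le_trans ih)// ltW. Qed.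

Let before n : natural_filtration B (s n) [set w | tau w <= s n].
Proof. by case: stau => _; apply. Qed.

Lemma adapted_stopped_log a k : adapted_at B (s k) (stopped_log a k).
Proof.
elim: k => [|k ih].
  rewrite /stopped_log; under eq_fun do rewrite big_ord0.
  by apply/adapted_atP; exact: measurable_cst.
rewrite /stopped_log; under eq_fun do rewrite big_ord_recr/=.
apply/adapted_atP; apply: measurable_funD.
  by apply/adapted_atP; apply: adapted_at_le ih; rewrite ltW.
apply: measurable_fun_ifT => //.
  apply: (measurable_fun_bool true); rewrite setTI.
  rewrite (_ : _ @^-1` _ = [set w | tau w <= s k]); last first.
    by apply/seteqP; split.
  exact: (natural_filtration_le (ltW (s_incr k)) (@before k)).
apply: measurable_funB => //; apply: measurable_funM => //.
by apply: measurable_funB; apply/adapted_atP; apply: adapted_at_process;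
  rewrite s_ge0 //= ltW.
Qed.

Lemma integral_stopped_exp a k : (\int[P]_w (expR (stopped_log a k w))%:E = 1)%E.
Proof.
elim: k => [|k ih].
  rewrite /stopped_log; under eq_integral do rewrite big_ord0 expR0.
  by rewrite integral_cst//= mul1e probability_setT.
pose b w : R := \1_[set w | tau w <= s k] w.
have mb : adapted_at B (s k) b.
  apply/adapted_atP; apply: measurable_indic; exact: before.
have mL : adapted_at B (s k) (fun w => expR (stopped_log a k w)).
  apply/adapted_atP; apply: measurableT_comp => //; apply/adapted_atP.
  exact: adapted_stopped_log.
pose Z w := expR (stopped_log a k w) * (1 - b w).
have b01 w : b w = 0 \/ b w = 1.
  by rewrite /b indicE; case: (_ \in _); [right|left].
have aZ : adapted_at B (s k) Z.
  apply/adapted_atP; apply: measurable_funM; first exact/adapted_atP.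
  by apply: measurable_funB => //; exact/adapted_atP.
have Z0 w : 0 <= Z w.
  by rewrite mulr_ge0 ?expR_ge0//; case: (b01 w) => ->; rewrite ?subr0 ?subrr.
have mB := brownian_measurable.
have mZ : measurable_fun setT Z := adapted_at_measurable mB aZ.
pose e w := expR (a k * (B (s k.+1) w - B (s k) w) - a k ^+ 2 * (s k.+1 - s k) / 2).
have me : measurable_fun setT e.
  apply: measurableT_comp => //; apply: measurable_funB => //.
  by apply: measurable_funM => //; apply: measurable_funB; exact: mB.
have mLb : measurable_fun setT (fun w => expR (stopped_log a k w) * b w).
  apply: (@adapted_at_measurable _ _ _ _ mB (s k)); apply/adapted_atP.
  by apply: measurable_funM; exact/adapted_atP.
have Lb0 w : 0 <= expR (stopped_log a k w) * b w.
  by rewrite mulr_ge0 ?expR_ge0//; case: (b01 w) => ->.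
transitivity (\int[P]_w ((expR (stopped_log a k w) * b w)%:E + (Z w * e w)%:E))%E.
  apply: eq_integral => w _; rewrite -EFinD; congr EFin.
  rewrite /stopped_log big_ord_recr/= expRD -/(stopped_log a k w) /Z /b indicE.
  case: ifPn => H.
    by rewrite mem_set//= subrr mulr0 mul0r addr0 expR0.
  by rewrite memNset ?subr0 ?mulr0 ?add0r ?mulr1//=; exact/negP.
rewrite ge0_integralD//; last 3 first.
- by apply/measurable_EFinP.
- by move=> w _; rewrite lee_fin mulr_ge0 ?expR_ge0.
- by apply/measurable_EFinP; exact: measurable_funM.
rewrite integral_adapted_expR_increment// -ge0_integralD//;
  try exact/measurable_EFinP.
- rewrite -ih; apply: eq_integral => w _; rewrite -EFinD; congr EFin.
  by rewrite /Z -mulrDr addrC subrK mulr1.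
all: by move=> w _; rewrite lee_fin.
Qed.

Lemma stopped_exp_sqr a k w :
  expR (stopped_log a k w) ^+ 2 <=
  expR (stopped_log (fun j => 2 * a j) k w) *
  expR (\sum_(j < k) a j ^+ 2 * (s j.+1 - s j)).
Proof.
rewrite -expRM_natl -expRD ler_expR /stopped_log -big_split/= mulr_sumr.
apply: ler_sum => j _; case: ifPn => _.
  by rewrite mulr0 add0r mulr_ge0 ?sqr_ge0// subr_ge0 ltW.
by rewrite le_eqVlt; apply/orP; left; apply/eqP; field.
Qed.

End exponential_martingale.

Section limits_of_integrals.
Local Open Scope ereal_scope.
Context d (T : measurableType d) (R : realType) (P : probability T R).
Implicit Types (f : nat -> T -> R) (g : T -> R).

Let cvg_integral_min f g (K : R) : (0 < K)%R ->
  (forall n, measurable_fun setT (f n)) -> measurable_fun setT g ->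
  (forall n w, (0 <= f n w)%R) -> (forall w, (0 <= g w)%R) ->
  {ae P, forall w, f n w @[n --> \oo] --> g w} ->
  \int[P]_w (Num.min (f n w) K)%:E @[n --> \oo] -->
  \int[P]_w (Num.min (g w) K)%:E.
Proof.
move=> K0 mf mg f0 g0 fg.
have mm (h : T -> R) : measurable_fun setT h ->
    measurable_fun setT (fun w => (Num.min (h w) K)%:E).
  by move=> mh; apply/measurable_EFinP; exact: measurable_minr.
have [| | |_ _] := @dominated_convergence _ _ _ P setT measurableT
  (fun n w => (Num.min (f n w) K)%:E) (fun w => (Num.min (g w) K)%:E)
  (cst K%:E) (fun n => mm _ (mf n)) (mm _ mg); last exact.
- apply: filterS fg => w fgw _; apply: cvg_EFin; first exact: nearW.
  apply: (@cvg_comp _ _ _ (f ^~ w) (fun y : R => Num.min y K) _ (nbhs (g w))) => //.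
  by apply: (@continuous_min _ _ (fun y : R => y) (fun=> K));
    [exact: cvg_id | exact: cvg_cst].
- exact: finite_measure_integrable_cst.
- apply: aeW => w n _; rewrite /= lee_fin ger0_norm.
    by rewrite ge_min lexx orbT.
  by rewrite le_min f0 ltW.
Qed.

Lemma ae_fatou f g (c : \bar R) :
  (forall n, measurable_fun setT (f n)) -> measurable_fun setT g ->
  (forall n w, (0 <= f n w)%R) -> (forall w, (0 <= g w)%R) ->
  {ae P, forall w, f n w @[n --> \oo] --> g w} ->
  (forall n, \int[P]_w (f n w)%:E <= c) -> \int[P]_w (g w)%:E <= c.
Proof.
move=> mf mg f0 g0 fg fc.
have mm (h : T -> R) (K : R) : measurable_fun setT h ->
    measurable_fun setT (fun w => (Num.min (h w) K)%:E).
  by move=> mh; apply/measurable_EFinP; exact: measurable_minr.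
have -> : \int[P]_w (g w)%:E =
    \int[P]_w limn (fun k => (Num.min (g w) k.+1%:R)%:E).
  apply: eq_integral => w _; apply/esym/cvg_lim => //.
  apply: cvg_near_cst; near=> k; congr EFin; apply/min_idPl.
  near: k; exists (Num.truncn (g w)).+1 => // k /= gk.
  rewrite (le_trans (ltW (truncnS_gt _)))// ler_nat.
  exact: leqW.
rewrite monotone_convergence//; last 3 first.
- by move=> k; exact: mm.
- by move=> k w _; rewrite lee_fin le_min g0 ler0n.
- move=> w _ a b ab; rewrite lee_fin le_min ge_min lexx/=.
  by rewrite ge_min ler_nat ltnS ab orbT.
apply: lime_le.
  apply: ereal_nondecreasing_is_cvgn => a b ab; apply: ge0_le_integral => //.
  - by move=> w _; rewrite lee_fin le_min g0 ler0n.
  - exact: mm.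
  - exact: mm.
  - move=> w _; rewrite lee_fin le_min ge_min lexx/=.
    by rewrite ge_min ler_nat ltnS ab orbT.
apply: nearW => k.
have H := @cvg_integral_min f g k.+1%:R (ltr0Sn _ _) mf mg f0 g0 fg.
rewrite -(cvg_lim _ H)//; apply: lime_le; first by apply/cvg_ex; eexists; exact: H.
apply: nearW => n; apply: le_trans (fc n); apply: ge0_le_integral => //.
- by move=> w _; rewrite lee_fin le_min f0 ler0n.
- exact: mm.
- exact/measurable_EFinP.
- by move=> w _; rewrite lee_fin ge_min lexx.
Unshelve. all: by end_near. Qed.

Lemma ae_integral_L2_bounded f g (a C : R) :
  (forall n, measurable_fun setT (f n)) -> measurable_fun setT g ->
  (forall n w, (0 <= f n w)%R) -> (forall w, (0 <= g w)%R) ->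
  {ae P, forall w, f n w @[n --> \oo] --> g w} ->
  (forall n, \int[P]_w (f n w)%:E = a%:E) ->
  (forall n, \int[P]_w (f n w ^+ 2)%:E <= C%:E) ->
  \int[P]_w (g w)%:E = a%:E.
Proof.
move=> mf mg f0 g0 fg fa fC; apply/eqP; rewrite eq_le; apply/andP; split.
  by apply: ae_fatou fg _ => // n; rewrite fa.
have C0 : (0 <= C)%R.
  rewrite -lee_fin; apply: le_trans (fC 0%N); apply: integral_ge0 => w _.
  by rewrite lee_fin sqr_ge0.
have mm (h : T -> R) (K : R) : measurable_fun setT h ->
    measurable_fun setT (fun w => (Num.min (h w) K)%:E).
  by move=> mh; apply/measurable_EFinP; exact: measurable_minr.
suff H (K : R) : (0 < K)%R -> a%:E <= \int[P]_w (g w)%:E + (C / K)%:E.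
  apply/lee_addgt0Pr => e e0.
  apply: (le_trans (H ((C + 1) / e)%R _)); first by rewrite divr_gt0// ltr_wpDl.
  rewrite leeD2l// lee_fin invfM invrK mulrA ler_piMl ?(ltW e0)//.
  by rewrite ler_pdivrMr ?ltr_wpDl// mul1r lerDl.
move=> K0; have H := cvg_integral_min K0 mf mg f0 g0 fg.
apply: (@le_trans _ _ (\int[P]_w (Num.min (g w) K)%:E + (C / K)%:E)); last first.
  rewrite leeD2r//; apply: ge0_le_integral => //.
  - by move=> w _; rewrite lee_fin le_min g0 ltW.
  - exact: mm.
  - exact/measurable_EFinP.
  - by move=> w _; rewrite lee_fin ge_min lexx.
rewrite -leeBlDr// -(cvg_lim _ H)//; apply: lime_ge.
  by apply/cvg_ex; eexists; exact: H.
apply: nearW => n; rewrite leeBlDr// -(fa n).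
apply: (@le_trans _ _ (\int[P]_w ((Num.min (f n w) K)%:E + (f n w ^+ 2 / K)%:E))).
  apply: ge0_le_integral => //.
  - by move=> w _; rewrite lee_fin.
  - exact/measurable_EFinP.
  - apply: emeasurable_funD; first exact: mm.
    by apply/measurable_EFinP; apply: measurable_funM => //; exact: measurable_funX.
  - move=> w _; rewrite lee_fin /Num.min; case: ifPn => [_|].
      by rewrite lerDl divr_ge0 ?sqr_ge0 ?(ltW K0).
    rewrite -leNgt => fK; rewrite (@le_trans _ _ (f n w ^+ 2 / K)%R)//.
      by rewrite ler_pdivlMr// expr2 ler_wpM2l.
    by rewrite lerDr ltW.
rewrite ge0_integralD//.
- rewrite leeD2l//.
  under eq_integral do rewrite mulrC EFinM.
  rewrite ge0_integralZl_EFin ?invr_ge0 ?(ltW K0)//.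
  + by rewrite mulrC EFinM lee_wpmul2l// lee_fin invr_ge0 ltW.
  + by move=> w _; rewrite lee_fin sqr_ge0.
  + by apply/measurable_EFinP; exact: measurable_funX.
- by move=> w _; rewrite lee_fin le_min f0 ltW.
- exact: mm.
- by move=> w _; rewrite lee_fin divr_ge0 ?sqr_ge0// ltW.
- by apply/measurable_EFinP; apply: measurable_funM => //; exact: measurable_funX.
Qed.

End limits_of_integrals.

Section uniform_continuity.
Context {R : realType}.
Implicit Types (f : R -> R) (a b e : R).

Lemma segment_unif_continuous f a b e :
  {within `[a, b], continuous f} -> 0 < e ->
  exists2 r, 0 < r & forall u v, a <= u <= b -> a <= v <= b ->
    `|u - v| < r -> `|f u - f v| < e.
Proof.
move=> cf e0; have e20 : 0 < e / 2 by rewrite divr_gt0.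
pose Q (r u : R) := a <= u <= b -> forall v, a <= v <= b ->
  `|u - v| < r -> `|f u - f v| < e.
have /compact_near_coveringP : compact `[a, b] by exact: segment_compact.
move=> /(_ _ (0 : R)^'+ Q (at_right_proper_filter _)) [].
  move=> x /[dup] xab; rewrite /= in_itv/= => xab'.
  move/subspace_continuousP : cf => /(_ _ xab)/cvgrPdist_lt/(_ _ e20).
  rewrite near_withinE => -[r /= r0 xr].
  have xr' y : a <= y <= b -> `|x - y| < r -> `|f x - f y| < e / 2.
    by move=> yab xy; apply: xr => //=; rewrite in_itv/=.
  exists (ball x (r / 2), [set d | 0 < d < r / 2]) => /=.
    split; first by apply: nbhsx_ballx; rewrite divr_gt0.
    near=> d; apply/andP; split => //.
    by near: d; apply: nbhs_right_lt; rewrite divr_gt0.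
  move=> [y d]/= [xy /andP[d0 dr]] yab v vab yv.
  rewrite /ball/= in xy.
  rewrite (splitr e) (le_lt_trans (ler_distD (f x) _ _))// ltrD//.
    rewrite distrC xr'// (lt_trans xy)// ltr_pdivrMr// mulr2n mulrDr mulr1 ltrDl//.
  rewrite xr'// (le_lt_trans (ler_distD y _ _))// (splitr r) ltrD//.
  exact: lt_trans dr.
move=> r /= r0 rQ; exists (r / 2); first by rewrite divr_gt0.
move=> u v uab vab uv; apply: (rQ (r / 2)) => //=.
- by rewrite sub0r normrN ger0_norm ?ltW ?divr_gt0// ltr_pdivrMr// mulr2n mulrDr mulr1 ltrDl.
- by rewrite divr_gt0.
Unshelve. all: by end_near. Qed.

Lemma segment_bounded f a b : a <= b -> {within `[a, b], continuous f} ->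
  exists2 M, 0 < M & forall u, a <= u <= b -> `|f u| <= M.
Proof.
move=> ab cf.
have [p _ fp] := EVT_max ab cf; have [q _ fq] := EVT_min ab cf.
exists (`|f p| + `|f q| + 1); first by rewrite ltr_wpDl// addr_ge0.
move=> u uab; rewrite ler_norml; apply/andP; split.
  rewrite lerNl; apply: (@le_trans _ _ (- f q)); first by rewrite lerN2 fq ?in_itv.
  by rewrite (le_trans (ler_norm _))// normrN addrAC ler_wpDl// addr_ge0.
by rewrite (le_trans (fp _ _)) ?in_itv// -addrA (le_trans (ler_norm _))// lerDl addr_ge0.
Qed.

End uniform_continuity.

Section pathwise_increments.
Context {R : realType}.
Context (a b x l : R) (X B g f f' A : R -> R).
Hypothesis ab : a < b.
Hypothesis cX : {within `[a, b], continuous X}.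
Hypothesis cg : {within `[a, b], continuous g}.
Hypothesis cf' : {within `[a, b], continuous f'}.
Hypothesis df : forall s, a <= s <= b -> is_derive s 1 f (f' s).
Hypothesis dA : forall s, a <= s <= b -> is_derive s 1 A (f s ^+ 2).
Hypothesis fg : forall s, a <= s <= b -> f' s * X s = f s * g s.
Hypothesis XE : forall s, a <= s <= b ->
  X s = x + \int[@lebesgue_measure R]_(u in `[a, s]) (- g u) + (B s - B a).

Definition log_martingale s := l * (f s * X s) - l ^+ 2 * A s / 2.

Let sub_itv u v : a <= u -> v <= b -> `[u, v] `<=` `[a, b].
Proof. by move=> au vb; apply: subset_itv; rewrite bnd_simp. Qed.

Let cf : {within `[a, b], continuous f}.
Proof.
apply: derivable_within_continuous => s; rewrite in_itv/= => sab.
by have [] := df sab.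
Qed.

Let cA : {within `[a, b], continuous A}.
Proof.
apply: derivable_within_continuous => s; rewrite in_itv/= => sab.
by have [] := dA sab.
Qed.

Lemma continuous_log_martingale : {within `[a, b], continuous log_martingale}.
Proof.
move=> s; apply: cvgB; last first.
  by apply: cvgM; [apply: cvgM; [exact: cvg_cst|exact: cA]|exact: cvg_cst].
by apply: cvgM; [exact: cvg_cst|apply: cvgM; [exact: cf|exact: cX]].
Qed.

Let mvt (F F' : R -> R) u v : a <= u -> u <= v -> v <= b ->
  (forall s, a <= s <= b -> is_derive s 1 F (F' s)) ->
  exists2 z, u <= z <= v & F v - F u = F' z * (v - u).
Proof.
move=> au uv vb dF.
have [||z] := @MVT_segment _ F F' u v uv.
- move=> s; rewrite in_itv/= => /andP[us sv]; apply: dF.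
  by rewrite (le_trans au (ltW us)) (le_trans (ltW sv) vb).
- apply: derivable_within_continuous => s; rewrite in_itv/= => /andP[us sv].
  have [] // := dF s _.
  by rewrite (le_trans au us) (le_trans sv vb).
by rewrite in_itv/= => zuv FE; exists z.
Qed.

Let X_increment u v : a <= u -> u <= v -> v <= b ->
  exists2 z, u <= z <= v & X v - X u - (B v - B u) = - g z * (v - u).
Proof.
move=> au uv vb.
pose D s := \int[@lebesgue_measure R]_(r in `[a, s]) (- g r).
have ig : (@lebesgue_measure R).-integrable `[a, b] (EFin \o (fun r => - g r)).
  apply: continuous_compact_integrable; first exact: segment_compact.
  by move=> s; apply: cvgN; exact: cg.
have -> : X v - X u - (B v - B u) = D v - D u.
  rewrite (XE (s := v)) ?(le_trans au uv)// (XE (s := u)) ?au ?(le_trans uv vb)//.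
  by rewrite /D; ring.
have cD := parameterized_integral_continuous (ltW ab) ig.
have [||z] := @MVT_segment _ D (fun r => - g r) u v uv.
- move=> s; rewrite in_itv/= => /andP[us sv].
  have as_ : a < s by exact: le_lt_trans us.
  have sb : s < b by exact: lt_le_trans vb.
  have cgs : {for s, continuous (fun r => - g r)}.
    apply: cvgN; apply: (within_continuous_continuous ab cg).
    by rewrite in_itv/= as_.
  have [dD D'] := continuous_FTC1_closed sb ig as_ cgs.
  by apply: DeriveDef; [exact: dD|rewrite -derive1E D'].
- by apply: continuous_subspaceW cD; exact: sub_itv.
by rewrite in_itv/= => zuv ->; exists z.
Qed.

(* The first-order terms f' X and f g of the two factors of the increment
   cancel, so only moduli of continuity remain. *)
Lemma log_martingale_increment e : 0 < e ->
  exists2 r, 0 < r & forall u v, a <= u -> u <= v -> v <= b -> v - u < r ->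
  `|log_martingale v - log_martingale u -
    (l * f u * (B v - B u) - (l * f u) ^+ 2 * (v - u) / 2)| <= e * (v - u).
Proof.
move=> e0.
have [MX MX0 bX] := segment_bounded (ltW ab) cX.
have [Mf Mf0 bf] := segment_bounded (ltW ab) cf.
have [M' M'0 bf'] := segment_bounded (ltW ab) cf'.
have cf2 : {within `[a, b], continuous (fun s => f s ^+ 2)}.
  by move=> s; apply: cvgM; exact: cf.
pose M := `|l| * (M' + MX + Mf) + l ^+ 2.
have M0 : 0 <= M.
  by rewrite addr_ge0 ?sqr_ge0// mulr_ge0// !addr_ge0// ltW.
pose k := e / (M + 1).
have k0 : 0 < k by rewrite divr_gt0// ltr_wpDl.
have [r1 r10 ucX] := segment_unif_continuous cX k0.
have [r2 r20 ucg] := segment_unif_continuous cg k0.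
have [r3 r30 ucf'] := segment_unif_continuous cf' k0.
have [r4 r40 ucf2] := segment_unif_continuous cf2 k0.
exists (Num.min (Num.min r1 r2) (Num.min r3 r4)).
  by rewrite !lt_min r10 r20 r30.
move=> u v au uv vb; rewrite !lt_min => /andP[/andP[v1 v2] /andP[v3 v4]].
have [z1 z1uv X1] := X_increment au uv vb.
have [z2 z2uv f2] := mvt au uv vb df.
have [z3 z3uv A3] := mvt au uv vb dA.
have inab z : u <= z <= v -> a <= z <= b.
  by move=> /andP[uz zv]; rewrite (le_trans au uz) (le_trans zv vb).
have near_u z r : u <= z <= v -> v - u < r -> `|z - u| < r.
  move=> /andP[uz zv] vur; rewrite ger0_norm ?subr_ge0//.
  by rewrite (le_lt_trans _ vur)// lerD2r.
have uab : a <= u <= b by rewrite au (le_trans uv).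
have vab : a <= v <= b by rewrite vb (le_trans au).
have vuv : u <= v <= v by rewrite uv lexx.
have BE : B v - B u = X v - X u + g z1 * (v - u).
  by rewrite -[RHS]opprK opprD -mulNr -X1; ring.
have -> : log_martingale v - log_martingale u -
    (l * f u * (B v - B u) - (l * f u) ^+ 2 * (v - u) / 2) =
  (l * (f' z2 * (X v - X u) + X u * (f' z2 - f' u) - f u * (g z1 - g u))
   - l ^+ 2 / 2 * (f z3 ^+ 2 - f u ^+ 2)) * (v - u).
  have H1 : f v = f u + f' z2 * (v - u) by rewrite -f2; ring.
  have H2 : A v = A u + f z3 ^+ 2 * (v - u) by rewrite -A3; ring.
  have H3 := fg uab.
  rewrite /log_martingale BE H1 H2.
  have -> : f' z2 * (X v - X u) + X u * (f' z2 - f' u) - f u * (g z1 - g u) =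
    f' z2 * X v - f u * g z1 + (f u * g u - f' u * X u) by ring.
  by rewrite H3; field.
rewrite normrM (ger0_norm (_ : 0 <= v - u)) ?subr_ge0// ler_wpM2r ?subr_ge0//.
have Mk : M * k <= e.
  rewrite /k mulrCA ler_piMr ?(ltW e0)// ler_pdivrMr ?ltr_wpDl// mul1r lerDl//.
apply: le_trans Mk; rewrite /M mulrDl; apply: (le_trans (ler_normB _ _)).
apply: lerD.
  rewrite normrM -mulrA ler_wpM2l// !mulrDl.
  apply: (le_trans (ler_normB _ _)); apply: lerD; last first.
    rewrite normrM; apply: ler_pM => //; first exact: bf.
    by apply/ltW/ucg => //; [exact: inab|exact: near_u].
  apply: (le_trans (ler_normD _ _)); apply: lerD.
    rewrite normrM; apply: ler_pM => //; first by apply: bf'; exact: inab.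
    by apply/ltW/ucX => //; exact: near_u.
  rewrite normrM; apply: ler_pM => //; first exact: bX.
  by apply/ltW/ucf' => //; [exact: inab|exact: near_u].
rewrite normrM ger0_norm ?divr_ge0 ?sqr_ge0//; apply: ler_pM => //.
- by rewrite divr_ge0 ?sqr_ge0.
- by rewrite ler_pdivrMr// ler_peMr ?sqr_ge0// ler1n.
- by apply/ltW/ucf2 => //; [exact: inab|exact: near_u].
Qed.

End pathwise_increments.

Section stopped_sums.
Context {R : realType}.
Implicit Types (F : R -> R) (D : R -> R -> R).

Definition grid (a b : R) (n j : nat) : R := a + (b - a) * (j%:R / n.+1%:R).

Section grid_theory.
Variables (a b : R).
Hypothesis ab : a < b.

Lemma grid0 n : grid a b n 0 = a.
Proof. by rewrite /grid mul0r mulr0 addr0. Qed.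

Lemma gridS n : grid a b n n.+1 = b.
Proof. by rewrite /grid divff ?pnatr_eq0// mulr1 addrC subrK. Qed.

Lemma grid_step n j : grid a b n j.+1 - grid a b n j = (b - a) / n.+1%:R.
Proof. by rewrite /grid -natr1; field; rewrite nat1r pnatr_eq0. Qed.

Lemma grid_step_gt0 n : 0 < (b - a) / n.+1%:R.
Proof. by rewrite divr_gt0// subr_gt0. Qed.

Lemma grid_lt n j : grid a b n j < grid a b n j.+1.
Proof. by rewrite -subr_gt0 grid_step grid_step_gt0. Qed.

Lemma grid_le n j k : (j <= k)%N -> grid a b n j <= grid a b n k.
Proof.
move=> jk; rewrite lerD2l ler_pM2l ?subr_gt0// ler_pM2r ?invr_gt0//.
by rewrite ler_nat.
Qed.

Lemma grid_in n j : (j <= n.+1)%N -> a <= grid a b n j <= b.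
Proof.
move=> jn; rewrite -[X in X <= _ <= _](grid0 n) -[X in _ <= _ <= X](gridS n).
by rewrite !grid_le.
Qed.

Lemma cvg_grid_step : (b - a) / n.+1%:R @[n --> \oo] --> 0.
Proof.
rewrite -[X in _ --> X](mulr0 (b - a)); apply: cvgM; first exact: cvg_cst.
exact: cvg_harmonic.
Qed.

Lemma stopped_telescope F tau n k : a <= tau -> (k <= n.+1)%N ->
  exists m, [/\ (m <= k)%N,
    `|grid a b n m - Num.min tau (grid a b n k)| <= (b - a) / n.+1%:R &
    \sum_(j < k) (if tau <= grid a b n j then 0
                  else F (grid a b n j.+1) - F (grid a b n j)) =
    F (grid a b n m) - F a].
Proof.
move=> atau; elim: k => [_|k ih kn].
  exists 0%N; rewrite big_ord0 grid0 subrr; split=> //.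
  by rewrite min_r// subrr normr0 ltW// grid_step_gt0.
have [m [mk uk sumk]] := ih (ltnW kn); rewrite big_ord_recr/=.
case: ifPn => [tauk|].
  exists m; split; [exact: leqW| |by rewrite sumk addr0].
  rewrite min_l; last by rewrite (le_trans tauk)// ltW// grid_lt.
  by rewrite min_l in uk.
rewrite -ltNge => ktau; exists k.+1; split=> //.
  have step := grid_step n k; rewrite /Num.min; case: ifPn => [tauk|_].
    by rewrite ger0_norm ?subr_ge0 ?(ltW tauk)// -step lerB// ltW.
  by rewrite subrr normr0 ltW// grid_step_gt0.
rewrite (eq_bigr (fun j : 'I_k => F (grid a b n j.+1) - F (grid a b n j))).
  rewrite -(big_mkord xpredT (fun j => F (grid a b n j.+1) - F (grid a b n j))).
  by rewrite telescope_sumr// grid0 addrC addrA subrK.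
move=> j _; rewrite ifF//; apply/negbTE; rewrite -ltNge (le_lt_trans _ ktau)//.
by rewrite grid_le// ltnW.
Qed.

Lemma cvg_stopped_sum F D tau : {within `[a, b], continuous F} -> a <= tau ->
  (forall e, 0 < e -> exists2 r, 0 < r & forall u v, a <= u -> u <= v -> v <= b ->
    v - u < r -> `|F v - F u - D u v| <= e * (v - u)) ->
  \sum_(j < n.+1) (if tau <= grid a b n j then 0
                   else D (grid a b n j) (grid a b n j.+1)) @[n --> \oo] -->
  F (Num.min tau b) - F a.
Proof.
move=> cF atau DF; apply/cvgrPdist_le => e e0.
have e1 : 0 < e / 2 by rewrite divr_gt0.
have e2 : 0 < e / 2 / (b - a) by rewrite divr_gt0// subr_gt0.
have [r1 r10 uF] := segment_unif_continuous cF e1.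
have [r2 r20 Dr] := DF _ e2.
have r0 : 0 < Num.min r1 r2 by rewrite lt_min r10.
have /cvgrPdist_lt/(_ _ r0) := cvg_grid_step.
apply: filterS => n; rewrite sub0r normrN ger0_norm ?(ltW (grid_step_gt0 n))//.
rewrite lt_min => /andP[h1 h2].
have [m [mn ub sumE]] := stopped_telescope F atau (leqnn n.+1).
have uab := grid_in mn; set u := grid a b n m in uab ub sumE.
rewrite gridS in ub.
have mab : a <= Num.min tau b <= b.
  by rewrite le_min atau (ltW ab) ge_min lexx orbT.
have -> : F (Num.min tau b) - F a -
    \sum_(j < n.+1) (if tau <= grid a b n j then 0
                     else D (grid a b n j) (grid a b n j.+1)) =
  (F (Num.min tau b) - F u) +
  \sum_(j < n.+1) (if tau <= grid a b n j then 0
     else F (grid a b n j.+1) - F (grid a b n j)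
          - D (grid a b n j) (grid a b n j.+1)).
  have -> : F (Num.min tau b) - F a = F (Num.min tau b) - F u + (F u - F a) by ring.
  rewrite -sumE -addrA -sumrB; congr (_ + _); apply: eq_bigr => j _.
  by case: ifPn; rewrite ?subrr.
rewrite (splitr e) (le_trans (ler_normD _ _))// lerD//.
  by apply/ltW/uF => //; rewrite distrC (le_lt_trans ub).
apply: (le_trans (ler_norm_sum _ _ _)).
apply: (@le_trans _ _ (\sum_(j < n.+1) (e / 2 / n.+1%:R))).
  apply: ler_sum => j _; case: ifPn => _.
    by rewrite normr0 divr_ge0// ltW.
  have /andP[aj _] : a <= grid a b n j <= b by apply: grid_in; rewrite ltnW.
  have /andP[_ jb] : a <= grid a b n j.+1 <= b by exact: grid_in.
  apply: (le_trans (Dr _ _ aj _ jb _)); first by rewrite ltW// grid_lt.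
    by rewrite grid_step.
  rewrite grid_step [leLHS](_ : _ = e / 2 / n.+1%:R)//; field.
  by apply/andP; split; [rewrite nat1r pnatr_eq0|rewrite subr_eq0 gt_eqF].
by rewrite big_const_ord iter_addr_0 -[leLHS]mulr_natr divfK ?pnatr_eq0.
Qed.

End grid_theory.

End stopped_sums.

(** * The bridge and its hitting time *)

Section power_of_remaining_time.
Context {R : realType}.
Implicit Types (p q s alpha : R).

Definition pow1 p s : R := expR (p * ln (1 - s)).

Lemma pow1_gt0 p s : 0 < pow1 p s. Proof. exact: expR_gt0. Qed.

Lemma pow1D p q s : pow1 (p + q) s = pow1 p s * pow1 q s.
Proof. by rewrite /pow1 mulrDl expRD. Qed.

Lemma pow1_0 s : pow1 0 s = 1. Proof. by rewrite /pow1 mul0r expR0. Qed.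

Lemma pow1N p s : pow1 (- p) s = (pow1 p s)^-1.
Proof. by rewrite /pow1 mulNr expRN. Qed.

Lemma pow1_1 s : s < 1 -> pow1 1 s = 1 - s.
Proof. by move=> s1; rewrite /pow1 mul1r lnK// posrE subr_gt0. Qed.

Lemma pow1_sqr p s : pow1 p s ^+ 2 = pow1 (2 * p) s.
Proof. by rewrite expr2 -pow1D mulr_natl mulr2n. Qed.

Lemma pow1_half s : s < 1 -> pow1 2^-1 s = Num.sqrt (1 - s).
Proof.
move=> s1; have -> : 1 - s = pow1 2^-1 s ^+ 2.
  by rewrite pow1_sqr divff// pow1_1.
by rewrite sqrtr_sqr gtr0_norm// pow1_gt0.
Qed.

Lemma is_derive_ln1 s : s < 1 ->
  is_derive s 1 (fun u => ln (1 - u)) (- (1 - s)^-1).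
Proof.
move=> s1; have s0 : 0 < 1 - s by rewrite subr_gt0.
have d1 : is_derive s 1 (fun u : R => 1 - u) (- 1).
  have := @is_deriveB R R R (cst 1) id s 1 0 1 (is_derive_cst (1 : R) s 1)
    (is_derive_id s (1 : R)).
  by rewrite sub0r.
have := @is_derive1_comp _ (@ln R) (fun u => 1 - u) s _ _ (is_derive1_ln s0) d1.
by rewrite mulrN1.
Qed.

Lemma is_derive_pow1 p s : s < 1 ->
  is_derive s 1 (pow1 p) (- p * pow1 (p - 1) s).
Proof.
move=> s1.
have d1 : is_derive s 1 (fun u => p * ln (1 - u)) (p * - (1 - s)^-1).
  exact: (@is_deriveZ R R R (fun u => ln (1 - u)) p s 1 _ (is_derive_ln1 s1)).
have := @is_derive1_comp _ (@expR R) _ s _ _ (is_derive_expR (p * ln (1 - s))) d1.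
rewrite (_ : expR _ * _ = - p * pow1 (p - 1) s)//.
by rewrite pow1D pow1N pow1_1// -/(pow1 p s); ring.
Qed.

Lemma continuous_pow1 p s : s < 1 -> {for s, continuous (pow1 p)}.
Proof.
move=> s1; apply: differentiable_continuous; apply/derivable1_diffP.
by have [] := is_derive_pow1 p s1.
Qed.

Definition drift alpha : R := (1 + alpha ^+ 2) / 2.

(* Antiderivative of [pow1 (- drift alpha) ^+ 2]. *)
Definition clock alpha s : R :=
  if alpha == 0 then - ln (1 - s) else pow1 (- alpha ^+ 2) s / alpha ^+ 2.

Lemma is_derive_clock alpha s : s < 1 ->
  is_derive s 1 (clock alpha) (pow1 (- drift alpha) s ^+ 2).
Proof.
move=> s1; rewrite pow1_sqr /clock /drift; case: eqVneq => [->|a0].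
  have := @is_deriveN R R R _ s 1 _ (is_derive_ln1 s1).
  rewrite opprK -{1}(pow1_1 s1) -pow1N (_ : - 1 = 2 * - ((1 + 0 ^+ 2) / 2))//.
  by field.
rewrite (_ : (fun s => _) = (fun s => (alpha ^+ 2)^-1 * pow1 (- alpha ^+ 2) s)).
  have := @is_deriveZ R R R _ (alpha ^+ 2)^-1 s 1 _ (is_derive_pow1 (- alpha ^+ 2) s1).
  rewrite opprK /GRing.scale/= mulKf ?expf_neq0//.
  rewrite (_ : - alpha ^+ 2 - 1 = 2 * - ((1 + alpha ^+ 2) / 2))//.
  by field.
by apply/funext => u; rewrite mulrC.
Qed.

End power_of_remaining_time.

Section bridge.
Context d (T : measurableType d) (R : realType) (P : probability T R).
Context (B : R -> T -> R) (hB : standard_brownian_motion P B).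
Context (alpha : R) (t : R) (ht : 0 <= t < 1) (x : R).
Context (X : R -> T -> R) (hX : sde_solution P alpha B t x X).
Context (tau : T -> R) (stau : stopping_time B t tau).

Let t0 : 0 <= t. Proof. by case/andP: ht. Qed.
Let t1 : t < 1. Proof. by case/andP: ht. Qed.
Let mB s : 0 <= s -> measurable_fun setT (B s).
Proof. by case: hB => + _ _ _ _; exact. Qed.
Let tau_ge w : t <= tau w. Proof. by case: stau => + _ => /(_ w)/andP[]. Qed.

Lemma bridge_continuous b w : b < 1 -> {within `[t, b], continuous (X ^~ w)}.
Proof.
move=> b1; have [_ /(_ w) cX _ _] := hX; apply: continuous_subspaceW cX.
by apply: subset_itvl; rewrite bnd_simp.
Qed.

Lemma bridge_measurable s : t <= s < 1 -> measurable_fun setT (X s).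
Proof.
move=> ts; have [aX _ _ _] := hX.
by apply: (@adapted_at_measurable _ _ _ _ (@mB) s) => C mC; exact: aX.
Qed.

Let tau_measurable : measurable_fun setT tau.
Proof. exact (stopping_time_measurable (@mB) t0 stau). Qed.

Lemma measurable_bridge_before b : t < b -> b < 1 ->
  measurable_fun setT (fun w => X (Num.min (tau w) b) w).
Proof.
move=> tb b1.
pose S n w := X t w + \sum_(j < n.+1) (if tau w <= grid t b n j then 0
  else X (grid t b n j.+1) w - X (grid t b n j) w).
apply: (@measurable_fun_cvg _ _ _ _ S).
  move=> n; apply: measurable_funD; first by apply: bridge_measurable; rewrite lexx.
  apply: measurable_sum => j; apply: measurable_fun_ifT => //.
    by apply: measurable_fun_ler => //; exact: measurable_cst.
  apply: measurable_funB; apply: bridge_measurable.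
    have /andP[-> gb] : t <= grid t b n j.+1 <= b by exact: grid_in.
    exact: le_lt_trans b1.
  have /andP[-> gb] : t <= grid t b n j <= b by apply: grid_in => //; rewrite ltnW.
  exact: le_lt_trans b1.
move=> w _.
have -> : X (Num.min (tau w) b) w = X t w + (X (Num.min (tau w) b) w - X t w) by ring.
apply: cvgD; first exact: cvg_cst.
apply: (@cvg_stopped_sum _ t b tb (X ^~ w) (fun u v => X v w - X u w)) => //.
  exact: bridge_continuous.
move=> e e0; exists 1 => // u v _ uv _ _; rewrite subrr normr0.
by rewrite mulr_ge0 ?subr_ge0// ltW.
Qed.

Definition bridge_log (l s : R) (w : T) : R :=
  log_martingale l (X ^~ w) (pow1 (- drift alpha)) (clock alpha) s.

Lemma measurable_bridge_log_before l b : t < b -> b < 1 ->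
  measurable_fun setT (fun w => bridge_log l (Num.min (tau w) b) w).
Proof.
move=> tb b1; rewrite /bridge_log /log_martingale.
have mtau : measurable_fun setT (fun w => Num.min (tau w) b).
  exact: measurable_minr.
have mpow p : measurable_fun setT (fun w => pow1 p (Num.min (tau w) b)).
  rewrite /pow1; apply: measurableT_comp => //; apply: measurable_funM => //.
  by apply: measurableT_comp => //; exact: measurable_funB.
apply: measurable_funB.
  apply: measurable_funM => //; apply: measurable_funM; first exact: mpow.
  exact: measurable_bridge_before.
apply: measurable_funM => //; apply: measurable_funM => //.
rewrite /clock; case: (alpha == 0).
  apply: measurableT_comp => //; apply: measurableT_comp => //.
  exact: measurable_funB.
by apply: measurable_funM => //; exact: mpow.
Qed.

Lemma ae_cvg_stopped_log l b : t < b -> b < 1 ->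
  {ae P, forall w, stopped_log B tau (grid t b n)
     (fun j => l * pow1 (- drift alpha) (grid t b n j)) n.+1 w @[n --> \oo] -->
   bridge_log l (Num.min (tau w) b) w - bridge_log l t w}.
Proof.
move=> tb b1; have [_ _ XE _] := hX; apply: filterS XE => w XE.
have lt1 s : t <= s <= b -> s < 1 by move=> /andP[_ sb]; exact: le_lt_trans b1.
have cX := bridge_continuous (w := w) b1.
pose f := pow1 (- drift alpha); pose f' s := drift alpha * pow1 (- drift alpha - 1) s.
pose g s := drift alpha * (X s w / (1 - s)).
have ccont (h : R -> R) : (forall s, s < 1 -> {for s, continuous h}) ->
    {within `[t, b], continuous h}.
  move=> ch; apply: continuous_in_subspaceT => s; rewrite inE/= in_itv/= => sb.
  by apply: ch; exact: lt1.
have cg : {within `[t, b], continuous g}.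
  move=> s; apply: cvgM; first exact: cvg_cst.
  apply: cvgM; first exact: cX.
  suff : {within `[t, b], continuous (fun s : R => (1 - s)^-1)} by exact.
  apply: ccont => u u1; apply: cvgV; first by rewrite subr_eq0 gt_eqF.
  by apply: cvgB; [exact: cvg_cst|exact: cvg_id].
have cf' : {within `[t, b], continuous f'}.
  apply: ccont => u u1; apply: cvgM; first exact: cvg_cst.
  exact: continuous_pow1.
have df s : t <= s <= b -> is_derive s 1 f (f' s).
  by move=> /lt1 s1; have := is_derive_pow1 (- drift alpha) s1; rewrite opprK.
have dA s : t <= s <= b -> is_derive s 1 (clock alpha) (f s ^+ 2).
  by move=> /lt1 s1; exact: is_derive_clock.
have fg s : t <= s <= b -> f' s * X s w = f s * g s.
  move=> /lt1 s1; rewrite /f' /f /g pow1D (pow1N 1) pow1_1//; ring.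
have XE' s : t <= s <= b -> X s w = x + \int[@lebesgue_measure R]_(u in `[t, s]) (- g u)
    + (B s w - B t w).
  move=> sb; rewrite XE; last by have /andP[-> _] := sb; exact: lt1.
  congr (_ + _ + _); apply: eq_Rintegral => u _; by rewrite /g mulNr.
have cL := continuous_log_martingale (l := l) cX df dA.
have LI := log_martingale_increment l tb cX cg cf' df dA fg XE'.
exact: (cvg_stopped_sum tb cL (tau_ge w) LI).
Qed.

Lemma integral_bridge_exp_before l b : t < b -> b < 1 ->
  (\int[P]_w (expR (bridge_log l (Num.min (tau w) b) w - bridge_log l t w))%:E = 1)%E.
Proof.
move=> tb b1.
have g0 n : 0 <= grid t b n 0 by rewrite grid0.
have gi n j : grid t b n j < grid t b n j.+1 by exact: grid_lt.
pose a n j := l * pow1 (- drift alpha) (grid t b n j).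
have [M M0 fM] : exists2 M, 0 < M &
    forall u, t <= u <= b -> `|pow1 (- drift alpha) u| <= M.
  apply: segment_bounded; first exact: ltW.
  apply: continuous_in_subspaceT => s; rewrite inE/= in_itv/= => /andP[_ sb].
  by apply: continuous_pow1; exact: le_lt_trans b1.
have mL c n : measurable_fun setT (stopped_log B tau (grid t b n) c n.+1).
  apply: (@adapted_at_measurable _ _ _ _ (@mB) (grid t b n n.+1)).
  exact: (@adapted_stopped_log _ _ _ B t tau stau _ (g0 n) (gi n)).
apply: (@ae_integral_L2_bounded _ _ _ P
  (fun n w => expR (stopped_log B tau (grid t b n) (a n) n.+1 w)) _ 1
  (expR (l ^+ 2 * M ^+ 2 * (b - t)))).
- by move=> n; apply: measurableT_comp => //; exact: mL.
- apply: measurableT_comp => //; apply: measurable_funB.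
    exact: measurable_bridge_log_before.
  rewrite /bridge_log /log_martingale; apply: measurable_funB => //.
  apply: measurable_funM => //; apply: measurable_funM => //.
  by apply: bridge_measurable; rewrite lexx.
- by move=> n w; exact: expR_ge0.
- by move=> w; exact: expR_ge0.
- apply: filterS (ae_cvg_stopped_log l tb b1) => w H.
  by apply: continuous_cvg => //; exact: continuous_expR.
- by move=> n; rewrite (integral_stopped_exp hB stau (g0 n) (gi n)).
- move=> n; rewrite -[leRHS]mule1.
  rewrite -(integral_stopped_exp hB stau (g0 n) (gi n) (fun j => 2 * a n j) n.+1).
  rewrite -(@ge0_integralZl_EFin _ _ _ P setT measurableT _ _ _ _ (expR_ge0 _)).
  + apply: ge0_le_integral => //.
    * by apply/measurable_EFinP; apply: measurable_funX; exact: measurableT_comp.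
    * apply/measurable_EFinP; apply: measurable_funM => //; exact: measurableT_comp.
    * move=> w _; rewrite -EFinM lee_fin.
      apply: (le_trans (stopped_exp_sqr B tau (gi n) (a n) n.+1 w)); rewrite mulrC.
      rewrite ler_wpM2r ?expR_ge0// ler_expR.
      apply: (@le_trans _ _ (\sum_(j < n.+1) l ^+ 2 * M ^+ 2 * ((b - t) / n.+1%:R))).
        apply: ler_sum => j _; rewrite grid_step//.
        rewrite ler_wpM2r ?(ltW (grid_step_gt0 _ _))// exprMn.
        rewrite ler_wpM2l ?sqr_ge0// -real_normK ?num_real//.
        by rewrite lerXn2r ?nnegrE ?(ltW M0)//; apply/fM/grid_in => //; rewrite ltnW.
      by rewrite big_const_ord iter_addr_0 -[leLHS]mulr_natr -[leLHS]mulrA divfK ?pnatr_eq0.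
  + by move=> w _; rewrite lee_fin expR_ge0.
  + by apply/measurable_EFinP; exact: measurableT_comp.
Qed.

End bridge.

Section gamma_boundary.
Context {R : realType}.
Implicit Types alpha s : R.

Lemma gamma1 alpha : gamma alpha 1 = 0.
Proof. by rewrite /gamma subrr sqrtr0 mulr0. Qed.

Lemma continuous_gamma alpha : continuous (gamma alpha).
Proof.
move=> s; apply: cvgM; first exact: cvg_cst.
apply: (@cvg_comp _ _ _ (fun u => 1 - u) Num.sqrt _ (nbhs (1 - s))).
  by apply: cvgB; [exact: cvg_cst|exact: cvg_id].
exact: sqrt_continuous.
Qed.

Lemma continuous_within_subgamma alpha a b (f : R -> R) :
  {within `[a, b], continuous f} ->
  {within `[a, b], continuous (fun s => f s - gamma alpha s)}.
Proof.
move=> cf s; apply: cvgB; first exact: cf.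
suff : {within `[a, b], continuous (gamma alpha)} by exact.
by apply: continuous_subspaceT => u; exact: continuous_gamma.
Qed.

End gamma_boundary.

Section hitting.
Context d (T : measurableType d) (R : realType) (P : probability T R).
Context (B : R -> T -> R).
Context (alpha : R) (t : R) (ht : 0 <= t < 1) (x : R).
Context (X : R -> T -> R) (hX : sde_solution P alpha B t x X).

Let t0 : 0 <= t. Proof. by case/andP: ht. Qed.
Let t1 : t < 1. Proof. by case/andP: ht. Qed.

Let S w := [set s : R | t <= s <= 1 /\ gamma alpha s <= X s w].
Let tau := hitting_time alpha X t.

Let S1 w : S w 1.
Proof.
split; first by rewrite lexx ltW.
by have [_ _ _ ->] := hX; rewrite gamma1.
Qed.

Let S_inf w : has_inf (S w).
Proof.
by split; [exists 1; exact: S1|exists t => s [/andP[]]].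
Qed.

Lemma hitting_time_bounds w : t <= tau w <= 1.
Proof.
apply/andP; split.
  by apply: lb_le_inf; [exists 1; exact: S1|move=> s [/andP[]]].
by apply: ge_inf; [case: (S_inf w)|exact: S1].
Qed.

Lemma hitting_time_le s w : t <= s <= 1 -> gamma alpha s <= X s w -> tau w <= s.
Proof. by move=> ts gX; apply: ge_inf; [case: (S_inf w)|]. Qed.

Lemma before_hitting_time s w : t <= s -> s < tau w -> X s w < gamma alpha s.
Proof.
move=> ts stau; rewrite ltNge; apply/negP => gX.
have /andP[_ tau1] := hitting_time_bounds w.
have := hitting_time_le _ gX; rewrite ts (ltW (lt_le_trans stau tau1)).
by move=> /(_ isT); rewrite leNgt stau.
Qed.

Let cD b w : b < 1 ->
  {within `[t, b], continuous (fun s => X s w - gamma alpha s)}.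
Proof.
move=> b1; apply: continuous_within_subgamma.
exact: (bridge_continuous hX).
Qed.

Lemma at_hitting_time w : tau w < 1 -> gamma alpha (tau w) <= X (tau w) w.
Proof.
move=> tau1; have /andP[ttau _] := hitting_time_bounds w.
rewrite leNgt; apply/negP => Xg.
pose b := (tau w + 1) / 2.
have taub : tau w < b by rewrite /b midf_lt.
have b1 : b < 1 by rewrite /b midf_lt.
have e0 : 0 < gamma alpha (tau w) - X (tau w) w by rewrite subr_gt0.
have [r r0 ucD] := segment_unif_continuous (cD (w := w) b1) e0.
have m0 : 0 < Num.min r (b - tau w) by rewrite lt_min r0 subr_gt0.
have [s [/andP[ts s1] gX]] := inf_adherent m0 (S_inf w).
rewrite -/(hitting_time alpha X t w) -/(tau w) => sm.
have taus : tau w <= s by apply: hitting_time_le; rewrite ?ts.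
have := ucD (tau w) s; rewrite ttau (ltW taub) ts/=.
have sr : `|tau w - s| < r.
  rewrite distrC ger0_norm ?subr_ge0// ltrBlDl (lt_le_trans sm)//.
  by rewrite lerD2l ge_min lexx.
have sb : s <= b.
  by rewrite ltW// (lt_le_trans sm)// -lerBrDl ge_min lexx orbT.
move=> /(_ isT sb sr); rewrite ltr_norml => /andP[+ _].
rewrite -subr_gt0; apply/negP; rewrite -leNgt.
rewrite (_ : _ - _ = gamma alpha s - X s w); first by rewrite subr_le0.
ring.
Qed.

Lemma hitting_time_eq_gamma w : X t w < gamma alpha t -> tau w < 1 ->
  X (tau w) w = gamma alpha (tau w).
Proof.
move=> Xt tau1; apply/eqP; rewrite eq_le at_hitting_time// andbT.
have /andP[ttau _] := hitting_time_bounds w.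
rewrite leNgt; apply/negP => Xg.
have {}ttau : t < tau w.
  rewrite lt_neqAle ttau andbT; apply/eqP => tE.
  by move: Xt; rewrite ltNge => /negP; apply; rewrite tE ltW.
have e0 : 0 < X (tau w) w - gamma alpha (tau w) by rewrite subr_gt0.
have [r r0 ucD] := segment_unif_continuous (cD (w := w) tau1) e0.
pose s := Num.max t (tau w - r / 2).
have ts : t <= s by rewrite le_max lexx.
have stau : s < tau w by rewrite gt_max ttau ltrBlDr ltrDl divr_gt0.
have := ucD (tau w) s; rewrite (ltW ttau) lexx ts (ltW stau)/=.
have sr : `|tau w - s| < r.
  rewrite ger0_norm ?subr_ge0 ?(ltW stau)//.
  rewrite (@le_lt_trans _ _ (r / 2))//.
    by rewrite lerBlDl -lerBlDr le_max lexx orbT.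
  by rewrite ltr_pdivrMr// mulr2n mulrDr mulr1 ltrDl.
move=> /(_ isT isT sr); rewrite ltr_norml => /andP[_].
have := before_hitting_time ts stau; lra.
Qed.

Let hit_before s w : t <= s < 1 ->
  tau w <= s <-> exists u, t <= u <= s /\ gamma alpha u <= X u w.
Proof.
move=> /andP[ts s1]; split=> [taus|[u [/andP[tu us] gX]]].
  exists (tau w); have /andP[-> _] := hitting_time_bounds w; rewrite taus.
  by split=> //; apply: at_hitting_time; exact: le_lt_trans s1.
by rewrite (le_trans _ us)// hitting_time_le// tu (le_trans us (ltW s1)).
Qed.

Lemma hitting_time_stopping_time : stopping_time B t tau.
Proof.
split; first exact: hitting_time_bounds.
have [aX _ _ _] := hX.
move=> s s0; have [s1|s1] := leP 1 s.
  rewrite (_ : [set _ | _] = setT).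
    by rewrite /natural_filtration; exact: (@measurableT _ (g_sigma_algebraType _)).
  apply/seteqP; split=> // w _ /=.
  by have /andP[_ taw] := hitting_time_bounds w; exact: le_trans s1.
have [st|ts] := ltP s t.
  rewrite (_ : [set _ | _] = set0).
    by rewrite /natural_filtration; exact: (@measurable0 _ (g_sigma_algebraType _)).
  apply/seteqP; split=> // w /=.
  by have /andP[ttau _] := hitting_time_bounds w; rewrite leNgt (lt_le_trans st).
have aset u e : t <= u <= s ->
    natural_filtration B s [set w | - e <= X u w - gamma alpha u].
  move=> /andP[tu us]; apply: (natural_filtration_le us).
  rewrite (_ : [set _ | _] = X u @^-1` `[gamma alpha u - e, +oo[); last first.
    by apply/seteqP; split=> w /=; rewrite in_itv/= andbT => H; lra.
  by apply: aX => //; rewrite tu (le_lt_trans us).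
pose D u w := X u w - gamma alpha u.
have hitD w : tau w <= s <-> exists u, t <= u <= s /\ 0 <= D u w.
  rewrite hit_before ?ts//; split=> -[u [tus gX]]; exists u; split=> //.
    by rewrite subr_ge0.
  by rewrite -subr_ge0.
have [tE|ts'] := eqVneq t s.
  rewrite (_ : [set _ | _] = [set w | - 0 <= D s w]).
    by apply: aset; rewrite ts lexx.
  apply/seteqP; split=> w /=; rewrite oppr0.
    by move=> /hitD[u [/andP[tu us]]]; have -> // : u = s; apply/le_anti; rewrite us -tE.
  by move=> Ds; apply/hitD; exists s; rewrite ts lexx.
have {}ts' : t < s by rewrite lt_neqAle ts'.
rewrite (_ : [set _ | _] = \bigcap_k \bigcup_m \bigcup_(j in [set j | (j <= m.+1)%N])
    [set w | - k.+1%:R^-1 <= D (grid t s m j) w]); last first.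
  apply/seteqP; split=> w /=.
    move=> /hitD[u [/andP[tu us] Du]] k _.
    have k0 : 0 < k.+1%:R^-1 :> R by rewrite invr_gt0.
    have [r r0 ucD] := segment_unif_continuous (cD (w := w) s1) k0.
    have [m hm] : exists m : nat, (s - t) / m.+1%:R < r.
      have /cvgrPdist_lt/(_ _ r0)[m _ /(_ m (leqnn m))] := cvg_grid_step t s.
      by rewrite /= sub0r normrN ger0_norm ?(ltW (grid_step_gt0 ts' _))//; exists m.
    have [j [jm uj _]] := stopped_telescope ts' id tu (leqnn m.+1).
    exists m => //; exists j => //=.
    rewrite gridS min_l// in uj.
    have := ucD (grid t s m j) u (grid_in ts' jm); rewrite tu us => /(_ isT).
    move=> /(_ (le_lt_trans uj hm)); rewrite ltr_norml => /andP[+ _].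
    by move: Du; rewrite /D => Du H; rewrite ltW// (lt_le_trans H)// lerBlDr lerDl.
  move=> H; apply/hitD.
  have [u] := EVT_max ts (cD (w := w) s1).
  rewrite in_itv/= => tus Du; exists u; split=> //.
  rewrite leNgt; apply/negP => Du0.
  have [k _ kD] : exists2 k : nat, True & k.+1%:R^-1 < - D u w.
    have u0 : 0 < - D u w by rewrite oppr_gt0.
    have /cvgrPdist_lt/(_ _ u0)[k _ /(_ k (leqnn k))] := @cvg_harmonic R.
    by rewrite /= sub0r normrN ger0_norm ?invr_ge0//; exists k.
  have [m _ [j /= jm Dj]] := H k Logic.I.
  have := Du (grid t s m j); rewrite in_itv/= (grid_in ts' jm) => /(_ isT).
  by move=> H0; move: kD; rewrite ltrNr ltNge (le_trans Dj H0).
apply: (@bigcap_measurable _ (g_sigma_algebraType (filtration_generator B s))) => // k _.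
apply: bigcup_measurable => m _; apply: bigcup_measurable => j /= jm.
by apply: aset; exact: grid_in.
Qed.

End hitting.

Section exponential_stopping.
Context d (T : measurableType d) (R : realType) (P : probability T R).
Context (B : R -> T -> R) (hB : standard_brownian_motion P B).
Context (alpha : R) (t : R) (ht : 0 <= t < 1) (x : R).
Context (X : R -> T -> R) (hX : sde_solution P alpha B t x X).
Context (tau : T -> R) (stau : stopping_time B t tau).

Let t0 : 0 <= t. Proof. by case/andP: ht. Qed.
Let t1 : t < 1. Proof. by case/andP: ht. Qed.
Let mtau : measurable_fun setT tau.
Proof.
apply: (@stopping_time_measurable _ _ _ B _ t) => //.
by move=> s s0; exact: (brownian_measurable hB).
Qed.

Let b n : R := 1 - (1 - t) / n.+2%:R.

Let tb n : t < b n.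
Proof.
rewrite /b -subr_gt0 (_ : _ - _ = (1 - t) * (1 - n.+2%:R^-1)); last by ring.
by rewrite mulr_gt0 ?subr_gt0// invf_lt1 ?ltr0n// ltr1n.
Qed.

Let b1 n : b n < 1.
Proof. by rewrite /b ltrBlDr ltrDl divr_gt0// subr_gt0. Qed.

Lemma cvg_b : b n @[n --> \oo] --> (1 : R).
Proof.
rewrite -[X in _ --> X]subr0; apply: cvgB; first exact: cvg_cst.
rewrite -[X in _ --> X](mulr0 (1 - t)); apply: cvgM; first exact: cvg_cst.
by have := @cvg_harmonic R; rewrite -cvg_shiftS.
Qed.

Let near_b s : s < 1 -> \forall n \near \oo, Num.min s (b n) = s.
Proof.
move=> s1; have s10 : 0 < 1 - s by rewrite subr_gt0.
have /cvgrPdist_lt/(_ _ s10) := cvg_b; apply: filterS => n.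
rewrite ger0_norm ?subr_ge0 ?(ltW (b1 n))// => H; apply/min_idPl.
by move: H; rewrite ltrD2l ltrN2 => /ltW.
Qed.

Let mlt1 : measurable_fun setT (fun w => tau w < 1).
Proof. by apply: measurable_fun_ltr. Qed.

Lemma measurable_bridge_stopped :
  measurable_fun setT (fun w => if tau w < 1 then X (tau w) w else 0).
Proof.
apply: (@measurable_fun_cvg _ _ _ _
  (fun n w => if tau w < 1 then X (Num.min (tau w) (b n)) w else 0)).
  move=> n; apply: measurable_fun_ifT => //.
  exact: (measurable_bridge_before hB ht hX stau (tb n) (b1 n)).
move=> w _; case: ifPn => [tau1|_]; last exact: cvg_cst.
apply: cvg_near_cst.
by apply: filterS (near_b tau1) => n ->.
Qed.

Lemma measurable_bridge_value : measurable_fun setT (fun w => X (tau w) w).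
Proof.
rewrite (_ : (fun w => _) = (fun w => if tau w < 1 then X (tau w) w else 0)).
  exact: measurable_bridge_stopped.
apply/funext => w; case: ifPn => //; rewrite -leNgt => tau1.
case: stau => /(_ w)/andP[_ taul] _; have -> : tau w = 1 by apply/le_anti; rewrite taul.
by case: hX.
Qed.

Lemma bridge_start : {ae P, forall w, X t w = x}.
Proof.
have [_ _ XE _] := hX; apply: filterS XE => w /(_ t).
by rewrite lexx t1 => /(_ isT) ->; rewrite set_itv1 Rintegral_set1 subrr !addr0.
Qed.

Definition exp_martingale (l D s : R) (w : T) : R :=
  expR (l * (pow1 (- drift alpha) s * X s w - D) - l ^+ 2 * clock alpha s / 2).

Let m0 (l D : R) : R :=
  expR (l * (pow1 (- drift alpha) t * x - D) - l ^+ 2 * clock alpha t / 2).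

Let exp_martingaleE l D s w : X t w = x ->
  exp_martingale l D s w =
  m0 l D * expR (bridge_log alpha X l s w - bridge_log alpha X l t w).
Proof.
move=> Xt; rewrite /exp_martingale /m0 -expRD /bridge_log /log_martingale Xt.
by congr expR; ring.
Qed.

Let f l D n w := exp_martingale l D (Num.min (tau w) (b n)) w.

Let mf l D n : measurable_fun setT (f l D n).
Proof.
rewrite /f /exp_martingale; apply: measurableT_comp => //.
have := measurable_bridge_log_before hB ht hX stau l (tb n) (b1 n).
have -> : (fun w => l * (pow1 (- drift alpha) (Num.min (tau w) (b n)) *
     X (Num.min (tau w) (b n)) w - D) -
     l ^+ 2 * clock alpha (Num.min (tau w) (b n)) / 2) =
   (fun w => bridge_log alpha X l (Num.min (tau w) (b n)) w - l * D).
  by apply/funext => w; rewrite /bridge_log /log_martingale; ring.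
by move=> mL; apply: measurable_funB.
Qed.

Let integral_f l D n : (\int[P]_w (f l D n w)%:E = (m0 l D)%:E)%E.
Proof.
have E := integral_bridge_exp_before hB ht hX stau l (tb n) (b1 n).
have mg : measurable_fun setT (fun w => (m0 l D * expR (bridge_log alpha X l
    (Num.min (tau w) (b n)) w - bridge_log alpha X l t w))).
  apply: measurable_funM => //; apply: measurableT_comp => //.
  apply: measurable_funB; 
    first exact (measurable_bridge_log_before hB ht hX stau l (tb n) (b1 n)).
  rewrite /bridge_log /log_martingale; apply: measurable_funB => //.
  apply: measurable_funM => //; apply: measurable_funM => //.
  by apply: (bridge_measurable hB hX); rewrite lexx.
transitivity (\int[P]_w ((m0 l D) * expR (bridge_log alpha X l
    (Num.min (tau w) (b n)) w - bridge_log alpha X l t w))%:E)%E.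
  apply: ge0_ae_eq_integral => //.
  - exact/measurable_EFinP.
  - exact/measurable_EFinP.
  - by move=> w _; rewrite lee_fin expR_ge0.
  - by move=> w _; rewrite lee_fin mulr_ge0 ?expR_ge0.
  - by apply: filterS bridge_start => w Xt _; rewrite /f exp_martingaleE.
under eq_integral do rewrite EFinM.
rewrite ge0_integralZl_EFin ?expR_ge0//; first by rewrite E mule1.
apply/measurable_EFinP; apply: measurableT_comp => //.
apply: measurable_funB.
  exact (measurable_bridge_log_before hB ht hX stau l (tb n) (b1 n)).
rewrite /bridge_log /log_martingale; apply: measurable_funB => //.
apply: measurable_funM => //; apply: measurable_funM => //.
by apply: (bridge_measurable hB hX); rewrite lexx.
Qed.

Let g l D w := if tau w < 1 then exp_martingale l D (tau w) w else 0.

Let cvg_g l D w : tau w < 1 -> f l D n w @[n --> \oo] --> g l D w.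
Proof.
move=> tau1; apply: cvg_near_cst; apply: filterS (near_b tau1) => n.
by rewrite /f /g tau1 => ->.
Qed.

Lemma measurable_exp_martingale_stopped l D : measurable_fun setT (g l D).
Proof.
apply: (@measurable_fun_cvg _ _ _ _ (fun n w => if tau w < 1 then f l D n w else 0)).
  by move=> n; apply: measurable_fun_ifT.
move=> w _; case: (boolP (tau w < 1)) => tau1; first exact: cvg_g.
by rewrite /g (negbTE tau1); exact: cvg_cst.
Qed.

Lemma exp_martingale_stopped_le l D : (\int[P]_w (g l D w)%:E <=
  (expR (l * (pow1 (- drift alpha) t * x - D) - l ^+ 2 * clock alpha t / 2))%:E)%E.
Proof.
have g0 w : 0 <= g l D w by rewrite /g; case: ifP; rewrite ?expR_ge0.
apply: (@ae_fatou _ _ _ P (fun n w => if tau w < 1 then f l D n w else 0)).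
- by move=> n; apply: measurable_fun_ifT.
- exact: measurable_exp_martingale_stopped.
- by move=> n w; case: ifP; rewrite ?expR_ge0.
- exact: g0.
- apply: aeW => w; case: (boolP (tau w < 1)) => tau1; first exact: cvg_g.
  by rewrite /g (negbTE tau1); exact: cvg_cst.
- move=> n; rewrite -(integral_f l D n); apply: ge0_le_integral => //.
  + by move=> w _; rewrite lee_fin; case: ifP; rewrite ?expR_ge0.
  + by apply/measurable_EFinP; apply: measurable_fun_ifT.
  + exact/measurable_EFinP.
  + by move=> w _; rewrite lee_fin; case: ifP; rewrite ?expR_ge0.
Qed.

Lemma exp_martingale_stopped_eq (bd : R -> R) l C : 0 < l ->
  {ae P, forall w s, t <= s -> s <= tau w -> s < 1 -> X s w <= bd s} ->
  (forall s, t <= s < 1 ->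
    l * (pow1 (- drift alpha) s * bd s) - l ^+ 2 * clock alpha s / 2 <= C) ->
  expR (l * (pow1 (- drift alpha) s * bd s) - l ^+ 2 * clock alpha s / 2)
    @[s --> (1 : R)^'-] --> 0 ->
  (\int[P]_w (g l 0 w)%:E =
  (expR (l * (pow1 (- drift alpha) t * x) - l ^+ 2 * clock alpha t / 2))%:E)%E.
Proof.
move=> l0 Xbd bdC cbd.
pose psi s := expR (l * (pow1 (- drift alpha) s * bd s) - l ^+ 2 * clock alpha s / 2).
have gE n : (\int[P]_w (f l 0 n w)%:E = (m0 l 0)%:E)%E by exact: integral_f.
have -> : expR (l * (pow1 (- drift alpha) t * x) - l ^+ 2 * clock alpha t / 2) =
  m0 l 0 by rewrite /m0 subr0.
have cpsi : psi (b n) @[n --> \oo] --> 0.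
  by move/cvg_at_leftP : cbd; apply; split; [exact: b1|exact: cvg_b].
have f_psi w s : X s w <= bd s -> exp_martingale l 0 s w <= psi s.
  move=> Xs; rewrite /exp_martingale /psi ler_expR subr0 lerD2r ler_pM2l//.
  by rewrite ler_pM2l// pow1_gt0.
have [|||||_ _ L] := @dominated_convergence _ _ _ P setT measurableT
  (fun n w => (f l 0 n w)%:E) (fun w => (g l 0 w)%:E) (cst (expR C)%:E).
- by move=> n; exact/measurable_EFinP.
- by apply/measurable_EFinP; exact: measurable_exp_martingale_stopped.
- apply: filterS Xbd => w Xbd _; apply: cvg_EFin; first exact: nearW.
  have [tau1|tau1] := ltP (tau w) 1; first exact: cvg_g.
  rewrite /g ltNge tau1/=.
  have fp n : f l 0 n w <= psi (b n).
    rewrite /f min_r; last by rewrite (le_trans (ltW (b1 n))).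
    by apply/f_psi/Xbd => //; rewrite ltW// (lt_le_trans (b1 n)).
  apply: (squeeze_cvgr _ (cvg_cst 0) cpsi); apply: nearW => n.
  by rewrite fp expR_ge0.
- exact: finite_measure_integrable_cst.
- apply: filterS Xbd => w Xbd n _; rewrite /= lee_fin ger0_norm ?expR_ge0//.
  have mb : Num.min (tau w) (b n) < 1 by rewrite gt_min b1 orbT.
  have tm : t <= Num.min (tau w) (b n).
    by rewrite le_min (ltW (tb n)) andbT; case: stau => /(_ w)/andP[].
  rewrite /f (le_trans (f_psi _ _ _))//.
    by apply: Xbd => //; rewrite ge_min lexx.
  by rewrite /psi ler_expR bdC// tm.
rewrite -(cvg_lim _ L)//.
by under eq_fun do rewrite gE; rewrite lim_cst.
Qed.

End exponential_stopping.

(** * Gamma integrals and Kummer functions *)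

Section half_line.
Context {R : realType}.
Local Notation mu := (@lebesgue_measure R).
Implicit Types (G : R -> R) (a r p : R).

Lemma half_line_measurable G : {in `]0, +oo[, continuous G} ->
  measurable_fun (`]0, +oo[%classic : set R) G.
Proof.
move=> cG; apply: open_continuous_measurable_fun; first exact: interval_open.
by move=> p; rewrite inE => p0; exact: cG.
Qed.

Lemma cvg_integral_half_line G r : 0 < r ->
  {in `]0, +oo[, continuous G} -> (forall p, 0 < p -> 0 <= G p) ->
  (\int[mu]_(p in `[(r / n.+1%:R)%R, +oo[) (G p)%:E @[n --> \oo] -->
   \int[mu]_(p in `]0%R, +oo[) (G p)%:E)%E.
Proof.
move=> r0 cG G0.
have rn n : 0 < r / n.+1%:R by rewrite divr_gt0.
have sub n : `[r / n.+1%:R, +oo[ `<=` `]0, +oo[.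
  by apply: subset_itvr; rewrite bnd_simp.
have -> : `]0%R, +oo[%classic = \bigcup_n `[r / n.+1%:R, +oo[%classic.
  apply/seteqP; split=> [p|p [n _]]; last exact: sub.
  rewrite /= in_itv/= andbT => p0.
  have pr0 : 0 < p / r by rewrite divr_gt0.
  have /cvgrPdist_lt/(_ _ pr0)[n _ /(_ n (leqnn n))] := @cvg_harmonic R.
  rewrite /= sub0r normrN ger0_norm ?invr_ge0// ltr_pdivlMr// => H.
  by exists n => //=; rewrite in_itv/= andbT ltW// mulrC.
apply: ge0_nondecreasing_set_cvg_integral => //.
- move=> m n mn; apply/subsetPset; apply: subset_itvr; rewrite bnd_simp.
  by rewrite ler_pM2l// lef_pV2 ?posrE// ler_nat.
- move=> n; apply/measurable_EFinP; apply: measurable_funS (sub n) _ => //.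
  exact: half_line_measurable.
- by move=> n p /sub; rewrite /= in_itv/= andbT lee_fin; exact: G0.
Qed.

Lemma half_line_scaling G r : 0 < r ->
  {in `]0, +oo[, continuous G} -> (forall p, 0 < p -> 0 <= G p) ->
  (\int[mu]_(p in `]0%R, +oo[) (G p)%:E =
   \int[mu]_(p in `]0%R, +oo[) (G (r * p) * r)%R%:E)%E.
Proof.
move=> r0 cG G0; have c1 := cvg_integral_half_line r0 cG G0.
have cGr : {in `]0, +oo[, continuous (fun p => G (r * p) * r)}.
  move=> p; rewrite in_itv/= andbT => p0; apply: cvgM; last exact: cvg_cst.
  apply: (@cvg_comp _ _ _ (fun p => r * p) G _ (nbhs (r * p))).
    by apply: cvgM; [exact: cvg_cst|exact: cvg_id].
  by apply: cG; rewrite in_itv/= andbT mulr_gt0.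
have G0r p : 0 < p -> 0 <= G (r * p) * r.
  by move=> p0; rewrite mulr_ge0 ?(ltW r0)// G0// mulr_gt0.
have c2 := cvg_integral_half_line ltr01 cGr G0r.
apply: (cvg_unique _ c1) => //; apply: cvg_trans c2.
apply: near_eq_cvg; apply: nearW => n.
have d1 : derive1 (fun p : R => r * p) = cst r.
  apply/funext => p; rewrite derive1E deriveM// derive_cst derive_id.
  by rewrite scaler0 addr0 /GRing.scale/= mulr1.
rewrite -[r / _]/(r * n.+1%:R^-1) div1r.
rewrite (@increasing_ge0_integration_by_substitutiony _ (fun p => r * p) G n.+1%:R^-1).
- by apply: eq_integral => p _; rewrite /= d1.
- by move=> p q _ _ pq; rewrite ltr_pM2l.
- by rewrite d1 => p _; exact: cvg_cst.
- by rewrite d1; apply: is_cvg_cst.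
- by rewrite d1; apply: is_cvg_cst.
- split.
    by move=> p _; exact: derivableM.
  apply: cvg_at_right_filter.
  by apply: cvgM; [exact: cvg_cst|exact: cvg_id].
- by apply: gt0_cvgMry.
- apply: continuous_in_subspaceT => p; rewrite inE/= in_itv/= andbT => rp.
  by apply: cG; rewrite in_itv/= andbT (lt_le_trans _ rp)// mulr_gt0.
- move=> p; rewrite in_itv/= andbT => rp; apply: G0.
  by rewrite (lt_trans _ rp)// mulr_gt0.
Qed.

End half_line.

Section laplace_gamma.
Context {R : realType}.
Local Notation mu := (@lebesgue_measure R).
Local Notation half := (`]0%R, +oo[%classic : set R).
Implicit Types (a b r p v : R).

Let continuous_powR a p : 0 < p -> {for p, continuous (fun q : R => q `^ a)}.
Proof.
move=> p0; apply: differentiable_continuous; apply/derivable1_diffP.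
by have [] := @is_derive1_powR R a p p0.
Qed.

Let le_powR_expR a r : 0 < a -> 0 < r ->
  exists2 K, 0 < K & forall p, 0 < p -> p `^ a <= K * expR (r * p).
Proof.
move=> a0 r0; pose e := r / a; have e0 : 0 < e by rewrite divr_gt0.
exists (expR (- (a * ln e))); first exact: expR_gt0.
move=> p p0; rewrite /powR gt_eqF// -expRD ler_expR.
have ep : 0 < e * p by rewrite mulr_gt0.
have : ln (1 + (e * p - 1)) <= e * p - 1 by apply: le_ln1Dx; lra.
rewrite addrC subrK lnM ?posrE// => H.
have -> : r * p = a * (e * p) by rewrite /e; field; rewrite gt_eqF.
by rewrite -mulrN -mulrDr ler_pM2l//; lra.
Qed.

Let cvg_inv_powR a : 0 < a -> (1 + p `^ a)^-1 @[p --> +oo] --> 0.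
Proof.
move=> a0; apply/cvgrPdist_le => e e0.
pose M := e^-1 `^ a^-1.
have M0 : M \is Num.real by rewrite num_real.
near=> p.
have p0 : 0 < p by near: p; exact: nbhs_pinfty_gt.
have Mp : M <= p by near: p; exact: nbhs_pinfty_ge.
have one : 0 < 1 + p `^ a by rewrite ltr_wpDr// powR_ge0.
rewrite sub0r normrN ger0_norm ?invr_ge0 ?(ltW one)//.
rewrite -[leRHS]invrK lef_pV2 ?posrE ?invr_gt0//.
rewrite (@le_trans _ _ (p `^ a)) ?ler_wpDl//.
have -> : e^-1 = M `^ a by rewrite -powRrM mulVf ?gt_eqF// powRr1// invr_ge0 ltW.
by apply: ge0_ler_powR; rewrite ?nnegrE ?powR_ge0 ?(ltW a0) ?(ltW p0).
Unshelve. all: by end_near. Qed.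

Let power_kernel_le1 a : 0 < a ->
  (\int[mu]_(p in half) (a * p `^ (a - 1) / (1 + p `^ a) ^+ 2)%:E <= 1)%E.
Proof.
move=> a0; pose f p := a * p `^ (a - 1) / (1 + p `^ a) ^+ 2.
have one p : 0 < 1 + p `^ a by rewrite ltr_wpDr// powR_ge0.
have cf : {in `]0, +oo[, continuous f}.
  move=> p; rewrite in_itv/= andbT => p0; apply: cvgM.
    by apply: cvgM; [exact: cvg_cst|exact: continuous_powR].
  apply: cvgV; first by rewrite gt_eqF// exprn_gt0.
  apply: (@continuous_comp _ _ _ (fun q => 1 + q `^ a) (fun y => y ^+ 2));
    last exact: exprn_continuous.
  by apply: cvgD; [exact: cvg_cst|exact: continuous_powR].
have f0 p : 0 <= f p.
  by rewrite /f divr_ge0 ?sqr_ge0// mulr_ge0 ?powR_ge0// ltW.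
have L := cvg_integral_half_line ltr01 cf (fun p _ => f0 p).
rewrite -(cvg_lim _ L)//; apply: lime_le.
  by apply/cvg_ex; eexists; exact: L.
apply: nearW => n; have c0 : 0 < 1 / n.+1%:R :> R by rewrite divr_gt0.
set c := 1 / _ in c0 *.
pose F p := - (1 + p `^ a)^-1.
have dF p : 0 < p -> is_derive p 1 F (f p).
  move=> p0.
  have d1 := @is_deriveD R R R _ _ p 1 _ _ (is_derive_cst (1 : R) p 1) (@is_derive1_powR R a p p0).
  have d2 := @is_deriveN R R R _ p 1 _
    (@is_deriveV R (fun q => 1 + q `^ a) p _ 1 (lt0r_neq0 (one p)) d1).
  rewrite (_ : f p = - (- (1 + p `^ a) ^- 2 *: (0 + a * p `^ (a - 1))))//.
  by rewrite /f add0r /GRing.scale/= mulNr opprK mulrC.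
rewrite (@ge0_continuous_FTC2y _ f F c 0) ?add0e; last 6 first.
- by move=> p _; exact: f0.
- apply: continuous_in_subspaceT => p; rewrite inE/= in_itv/= andbT => cp.
  by apply: cf; rewrite in_itv/= andbT (lt_le_trans c0).
- by rewrite -oppr0; apply: cvgN; exact: cvg_inv_powR.
- by move=> p cp; have [] := dF p (lt_trans c0 cp).
- apply: cvg_at_right_filter.
  apply: differentiable_continuous; apply/derivable1_diffP.
  by have [] := dF c c0.
- move=> p; rewrite in_itv/= andbT => cp; rewrite derive1E.
  by have [] := dF p (lt_trans c0 cp).
by rewrite -EFinN lee_fin opprK invf_le1// lerDl powR_ge0.
Qed.

Lemma integrable_gamma a r : 0 < a -> 0 < r ->
  mu.-integrable half (fun p => (p `^ (a - 1) * expR (- (r * p)))%:E).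
Proof.
move=> a0 r0.
have [K K0 HK] := le_powR_expR a0 (divr_gt0 r0 (ltr0n _ 2)).
pose f p := a * p `^ (a - 1) / (1 + p `^ a) ^+ 2.
have one p : 0 < 1 + p `^ a by rewrite ltr_wpDr// powR_ge0.
have mf : measurable_fun half (EFin \o f).
  apply/measurable_EFinP; apply: half_line_measurable => p.
  rewrite in_itv/= andbT => p0; apply: cvgM.
    by apply: cvgM; [exact: cvg_cst|exact: continuous_powR].
  apply: cvgV; first by rewrite gt_eqF// exprn_gt0.
  apply: (@continuous_comp _ _ _ (fun q => 1 + q `^ a) (fun y => y ^+ 2));
    last exact: exprn_continuous.
  by apply: cvgD; [exact: cvg_cst|exact: continuous_powR].
have f0 p : 0 <= f p.
  by rewrite /f divr_ge0 ?sqr_ge0// mulr_ge0 ?powR_ge0// ltW.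
have If : mu.-integrable half (EFin \o f).
  apply/integrableP; split=> //.
  under eq_integral => p _ do rewrite /= ger0_norm ?f0//.
  by apply: le_lt_trans (power_kernel_le1 a0) _; rewrite ltry.
apply: (@le_integrable _ _ _ mu half _ _ (fun p => ((1 + K) ^+ 2 / a)%:E * (f p)%:E)%E) => //.
- apply/measurable_EFinP; apply: half_line_measurable => p.
  rewrite in_itv/= andbT => p0; apply: cvgM; first exact: continuous_powR.
  apply: continuous_comp; last exact: continuous_expR.
  by apply: cvgN; apply: cvgM; [exact: cvg_cst|exact: cvg_id].
- move=> p; rewrite /= in_itv/= andbT => p0; rewrite lee_fin.
  rewrite ger0_norm ?mulr_ge0 ?powR_ge0 ?expR_ge0//.
  rewrite ger0_norm; last first.
    by rewrite mulr_ge0// divr_ge0 ?sqr_ge0// ltW.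
  have -> : (1 + K) ^+ 2 / a * f p = p `^ (a - 1) * ((1 + K) ^+ 2 / (1 + p `^ a) ^+ 2).
    by rewrite /f; field; rewrite !gt_eqF.
  rewrite ler_wpM2l ?powR_ge0// expRN -[leLHS]mul1r ler_pdivrMr ?expR_gt0//.
  rewrite mulrAC ler_pdivlMr ?exprn_gt0// mul1r.
  have -> : expR (r * p) = expR (r / 2 * p) ^+ 2.
    by rewrite -expRM_natl; congr expR; field.
  rewrite -exprMn lerXn2r ?nnegrE ?(ltW (one p))//.
    by rewrite mulr_ge0 ?expR_ge0// addr_ge0// ltW.
  rewrite mulrDl mul1r lerD ?HK//.
  by rewrite -expR0 ler_expR mulr_ge0 ?divr_ge0 ?(ltW r0) ?(ltW p0).
- exact: integrableZl.
Qed.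

Definition laplace_kernel a v p : R :=
  p `^ (a - 1) * expR (v * Num.sqrt (2 * p) - p).

Definition laplace a v : R := \int[mu]_(p in half) laplace_kernel a v p.

Lemma laplace_kernel_ge0 a v p : 0 <= laplace_kernel a v p.
Proof. by rewrite mulr_ge0 ?powR_ge0 ?expR_ge0. Qed.

Lemma continuous_laplace_kernel a v : {in `]0, +oo[, continuous (laplace_kernel a v)}.
Proof.
move=> p; rewrite in_itv/= andbT => p0; apply: cvgM; first exact: continuous_powR.
apply: continuous_comp; last exact: continuous_expR.
apply: cvgB; last exact: cvg_id.
apply: cvgM; first exact: cvg_cst.
apply: (@cvg_comp _ _ _ (fun u => 2 * u) Num.sqrt _ (nbhs (2 * p))).
  by apply: cvgM; [exact: cvg_cst|exact: cvg_id].
exact: sqrt_continuous.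
Qed.

Lemma integrable_laplace_kernel a v : 0 < a ->
  mu.-integrable half (EFin \o laplace_kernel a v).
Proof.
move=> a0; have I1 := integrable_gamma a0 (divr_gt0 ltr01 (ltr0n _ 2)).
apply: (@le_integrable _ _ _ mu half _ _
  (fun p => (expR (v ^+ 2))%:E * (p `^ (a - 1) * expR (- (1 / 2 * p)))%:E)%E) => //.
- apply/measurable_EFinP; apply: half_line_measurable.
  exact: continuous_laplace_kernel.
- move=> p; rewrite /= in_itv/= andbT => p0; rewrite lee_fin.
  rewrite ger0_norm ?laplace_kernel_ge0// ger0_norm; last first.
    by rewrite !mulr_ge0 ?expR_ge0 ?powR_ge0.
  rewrite /laplace_kernel mulrCA ler_wpM2l ?powR_ge0// -expRD ler_expR.
  have := sqr_sqrtr (ltW (mulr_gt0 (ltr0n _ 2) p0)).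
  have := sqr_ge0 (v - Num.sqrt (2 * p) / 2).
  set s := Num.sqrt _; rewrite sqrrB expr_div_n => H1 H2.
  by nra.
- exact: integrableZl.
Qed.

Lemma laplaceE a v : 0 < a ->
  (\int[mu]_(p in half) (laplace_kernel a v p)%:E)%E = (laplace a v)%:E.
Proof.
by move=> a0; rewrite /laplace /Rintegral fineK// integrable_fin_num// integrable_laplace_kernel.
Qed.

Lemma laplace0 a : laplace a 0 = Gamma a.
Proof.
rewrite /laplace /Gamma; apply: eq_Rintegral => p _.
by rewrite /laplace_kernel mul0r add0r.
Qed.

Lemma laplace_scaling a v r : 0 < a -> 0 < r ->
  (\int[mu]_(p in half) (p `^ (a - 1) * expR (v * Num.sqrt (2 * p) - r * p))%:E =
   (r `^ (- a) * laplace a (v / Num.sqrt r))%:E)%E.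
Proof.
move=> a0 r0; have sr0 : 0 < Num.sqrt r by rewrite sqrtr_gt0.
rewrite EFinM -laplaceE//.
rewrite (half_line_scaling r0 (@continuous_laplace_kernel a (v / Num.sqrt r))
  (fun p _ => laplace_kernel_ge0 _ _ p)).
rewrite -ge0_integralZl_EFin ?powR_ge0//.
- apply: eq_integral => p; rewrite inE/= in_itv/= andbT => p0.
  rewrite -EFinM; congr EFin; rewrite /laplace_kernel powRM ?ltW//.
  rewrite (_ : 2 * (r * p) = r * (2 * p)); last by ring.
  rewrite (sqrtrM (2 * p)) ?(ltW r0)//.
  have -> : v / Num.sqrt r * (Num.sqrt r * Num.sqrt (2 * p)) = v * Num.sqrt (2 * p).
    by field; rewrite gt_eqF.
  have -> : r `^ (- a) = (r `^ (a - 1) * r)^-1.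
    by rewrite powRN mulrC mulr_powRB1 ?ltW.
  field.
  by rewrite !gt_eqF// powR_gt0.
- by move=> p _; rewrite lee_fin mulr_ge0 ?laplace_kernel_ge0// ltW.
- apply/measurable_EFinP; apply: half_line_measurable => p.
  rewrite in_itv/= andbT => p0; apply: cvgM; last exact: cvg_cst.
  apply: (@cvg_comp _ _ _ (fun u => r * u) (laplace_kernel a (v / Num.sqrt r)) _ (nbhs (r * p))).
    by apply: cvgM; [exact: cvg_cst|exact: cvg_id].
  by apply: continuous_laplace_kernel; rewrite in_itv/= andbT mulr_gt0.
Qed.

Lemma laplace_gt0 a v : 0 < a -> 0 < laplace a v.
Proof.
move=> a0; have c12 : {within `[1, 2], continuous (laplace_kernel a v)}.
  apply: continuous_in_subspaceT => p; rewrite inE/= in_itv/= => /andP[p1 _].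
  by apply: continuous_laplace_kernel; rewrite in_itv/= andbT (lt_le_trans ltr01).
have [c c12' cmin] := EVT_min (ler1n _ 2) c12.
have c0 : 0 < c by move: c12'; rewrite in_itv/= => /andP[+ _]; exact: lt_le_trans.
have kc0 : 0 < laplace_kernel a v c by rewrite mulr_gt0 ?powR_gt0 ?expR_gt0.
apply: lt_le_trans kc0 _; rewrite -lee_fin -laplaceE//.
have sub : `[1%R, 2%R] `<=` half.
  by apply: subset_itv; rewrite bnd_simp.
have mk : measurable_fun half (EFin \o laplace_kernel a v).
  by apply/measurable_EFinP; apply: half_line_measurable; exact: continuous_laplace_kernel.
apply: (@le_trans _ _ (\int[mu]_(p in `[1%R, 2%R]) (laplace_kernel a v p)%:E)%E); last first.
  by apply: ge0_subset_integral => // p _; rewrite lee_fin laplace_kernel_ge0.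
apply: (@le_trans _ _ (\int[mu]_(p in `[1%R, 2%R]) (laplace_kernel a v c)%:E)%E).
  rewrite integral_cst//= lebesgue_measure_itv/= lte_fin ltr1n/= -EFinD.
  by rewrite (_ : 2 - 1 = 1)%R ?mule1//; lra.
apply: ge0_le_integral => //.
- by move=> p _; rewrite lee_fin laplace_kernel_ge0.
- exact: measurable_funS mk.
Qed.

End laplace_gamma.

Section laplace_derivative.
Context {R : realType}.
Local Notation mu := (@lebesgue_measure R).
Local Notation half := (`]0%R, +oo[%classic : set R).
Implicit Types (a b r p v : R).

Lemma laplace_kernel_half a v p : 0 < p ->
  Num.sqrt (2 * p) * laplace_kernel a v p =
  Num.sqrt 2 * laplace_kernel (a + 2^-1) v p.
Proof.
move=> p0; rewrite /laplace_kernel sqrtrM// -(powR12_sqrt (ltW p0)).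
rewrite (_ : a + 2^-1 - 1 = 2^-1 + (a - 1)); last by ring.
rewrite (@powRD _ p 2^-1 (a - 1)); last by rewrite (gt_eqF p0) implybT.
by rewrite !mulrA.
Qed.

Let is_derive_laplace_kernel a v p :
  is_derive v 1 (fun u => laplace_kernel a u p)
    (Num.sqrt (2 * p) * laplace_kernel a v p).
Proof.
have d1 : is_derive v 1 (fun u => u * Num.sqrt (2 * p) - p) (Num.sqrt (2 * p)).
  have d2 := @is_deriveZ R R R id (Num.sqrt (2 * p)) v 1 _ (is_derive_id v 1).
  have := @is_deriveB R R R _ (cst p) v 1 _ _ d2 (is_derive_cst p v 1).
  rewrite subr0 /GRing.scale/= mulr1.
  have -> : (fun u => u * Num.sqrt (2 * p) - p) = Num.sqrt (2 * p) \*: id - cst p.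
    apply/funext => u; exact: (congr1 (fun y => y - p) (mulrC u _)).
  exact.
have -> : Num.sqrt (2 * p) * laplace_kernel a v p =
    p `^ (a - 1) *: (expR (v * Num.sqrt (2 * p) - p) * Num.sqrt (2 * p)).
  by rewrite /laplace_kernel /GRing.scale/=; ring.
exact: (@is_deriveZ R R R _ (p `^ (a - 1)) v 1 _
  (@is_derive1_comp _ (@expR R) _ v _ _ (is_derive_expR _) d1)).
Qed.

Let partial_laplace_kernel a v p : partial1of2 (laplace_kernel a) v p =
  Num.sqrt (2 * p) * laplace_kernel a v p.
Proof. by rewrite /partial1of2 derive1E; have [] := is_derive_laplace_kernel a v p. Qed.

Lemma is_derive_laplace a v : 0 < a ->
  is_derive v 1 (laplace a) (Num.sqrt 2 * laplace (a + 2^-1) v).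
Proof.
move=> a0; have a20 : 0 < a + 2^-1 by rewrite addr_gt0.
pose G p := Num.sqrt 2 * laplace_kernel (a + 2^-1) (`|v| + 1) p.
have G0 p : 0 <= G p by rewrite mulr_ge0 ?laplace_kernel_ge0.
have IG : mu.-integrable half (EFin \o G).
  by apply: (integrableZl _ _ (integrable_laplace_kernel (`|v| + 1) a20)).
have I_v : `](v - 1), (v + 1)[%classic v by rewrite /= in_itv/=; lra.
have If u : `](v - 1), (v + 1)[%classic u -> mu.-integrable half (EFin \o laplace_kernel a u).
  by move=> _; exact: integrable_laplace_kernel.
have df u p : `](v - 1), (v + 1)[%classic u -> half p -> derivable (laplace_kernel a ^~ p) u 1.
  by move=> _ _; have [] := is_derive_laplace_kernel a u p.
have fG u p : `](v - 1), (v + 1)[%classic u -> half p ->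
    `|partial1of2 (laplace_kernel a) u p| <= G p.
  rewrite /= !in_itv/= andbT => /andP[vu uv] p0.
  rewrite partial_laplace_kernel laplace_kernel_half//.
  rewrite ger0_norm ?mulr_ge0 ?laplace_kernel_ge0//.
  rewrite ler_wpM2l// ler_wpM2l ?powR_ge0// ler_expR lerD2r ler_wpM2r//.
    by have := ler_norm v; lra.
  exact: powR_ge0.
have mh : measurable (half : set (measurableTypeR R)) by [].
apply: DeriveDef.
  exact (derivable_under_integral mh I_v If df G0 IG fG).
rewrite -derive1E (differentiation_under_integral mh I_v If df G0 IG fG).
transitivity (\int[mu]_(p in half) (Num.sqrt 2 * laplace_kernel (a + 2^-1) v p)).
  apply: eq_Rintegral => p; rewrite inE/= in_itv/= andbT => p0.
  by rewrite partial_laplace_kernel laplace_kernel_half.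
by rewrite RintegralZl//; exact: integrable_laplace_kernel.
Qed.

Lemma continuous_laplace a : 0 < a -> continuous (laplace a).
Proof.
move=> a0 v; apply: differentiable_continuous; apply/derivable1_diffP.
by have [] := is_derive_laplace v a0.
Qed.

Lemma laplace_tangent a v w : 0 < a ->
  laplace a w + Num.sqrt 2 * laplace (a + 2^-1) w * (v - w) <= laplace a v.
Proof.
move=> a0; have a20 : 0 < a + 2^-1 by rewrite addr_gt0.
have mh : measurable (half : set (measurableTypeR R)) by [].
have I1 : mu.-integrable half (EFin \o (fun p =>
    Num.sqrt 2 * (v - w) * laplace_kernel (a + 2^-1) w p)).
  exact: (integrableZl _ _ (integrable_laplace_kernel w a20)).
have I2 := integrable_laplace_kernel w a0.
have -> : laplace a w + Num.sqrt 2 * laplace (a + 2^-1) w * (v - w) =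
  \int[mu]_(p in half) (laplace_kernel a w p +
     Num.sqrt 2 * (v - w) * laplace_kernel (a + 2^-1) w p).
  rewrite RintegralD// RintegralZl//; first by rewrite /laplace; ring.
  exact: integrable_laplace_kernel.
apply: le_Rintegral => //.
- by have := integrableD mh I2 I1.
- exact: integrable_laplace_kernel.
- move=> p; rewrite /= in_itv/= andbT => p0.
  rewrite mulrAC -laplace_kernel_half// /laplace_kernel.
  set s := Num.sqrt _; set y := p `^ _.
  have -> : expR (v * s - p) = expR (w * s - p) * expR ((v - w) * s).
    by rewrite -expRD; congr expR; ring.
  have -> : y * expR (w * s - p) + s * (y * expR (w * s - p)) * (v - w) =
    y * expR (w * s - p) * (1 + (v - w) * s) by ring.
  rewrite [leRHS]mulrA ler_wpM2l ?mulr_ge0 ?powR_ge0 ?expR_ge0//.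
  exact: expR_ge1Dx.
Qed.

Let kernel_growth a v p : 0 <= v -> 0 < p ->
  laplace_kernel a 0 p * (v * Num.sqrt (2 * p) - 2) <=
  laplace_kernel a v p * (v * Num.sqrt (2 * p) - 1).
Proof.
move=> v0 p0; rewrite /laplace_kernel mul0r add0r expRD.
set y := v * _; have y0 : 0 <= y by rewrite mulr_ge0.
rewrite [leRHS](_ : _ = p `^ (a - 1) * expR (- p) * ((y - 1) * expR y)); last by ring.
rewrite ler_wpM2l ?mulr_ge0 ?powR_ge0 ?expR_ge0//.
have [y1|y1] := leP y 1.
  have := expR_ge1Dx (- y); rewrite expRN => H.
  have e0 := expR_gt0 y.
  have : (1 - y) * expR y <= 1 by rewrite -ler_pdivlMr// mul1r.
  lra.
have := expR_ge1Dx y => H.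
have : (y - 1) * (1 + y) <= (y - 1) * expR y by rewrite ler_wpM2l//; lra.
nra.
Qed.

Lemma laplace_root a : 0 < a ->
  exists2 v, 0 < v & v * (Num.sqrt 2 * laplace (a + 2^-1) v) = laplace a v.
Proof.
move=> a0; have a20 : 0 < a + 2^-1 by rewrite addr_gt0.
pose g v := v * (Num.sqrt 2 * laplace (a + 2^-1) v) - laplace a v.
have cg : continuous g.
  move=> v; apply: cvgB; last exact: continuous_laplace.
  apply: cvgM; first exact: cvg_id.
  by apply: cvgM; [exact: cvg_cst|exact: continuous_laplace].
have F0 := laplace_gt0 0 a0; have F1 := laplace_gt0 0 a20.
have s20 : 0 < Num.sqrt 2 :> R by rewrite sqrtr_gt0.
pose V := 2 * laplace a 0 / (Num.sqrt 2 * laplace (a + 2^-1) 0).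
have V0 : 0 < V by rewrite divr_gt0 ?mulr_gt0.
have gV : 0 <= g V.
  have mh : measurable (half : set (measurableTypeR R)) by [].
  have I1 v : mu.-integrable half (EFin \o (fun p =>
      V * Num.sqrt 2 * laplace_kernel (a + 2^-1) v p)).
    exact: (integrableZl _ _ (integrable_laplace_kernel v a20)).
  have I2 k v : mu.-integrable half (EFin \o (fun p => k * laplace_kernel a v p)).
    exact: (integrableZl _ _ (integrable_laplace_kernel v a0)).
  have E k v : V * (Num.sqrt 2 * laplace (a + 2^-1) v) - k * laplace a v =
    \int[mu]_(p in half) (V * Num.sqrt 2 * laplace_kernel (a + 2^-1) v p -
       k * laplace_kernel a v p).
    rewrite RintegralB//.
    rewrite !RintegralZl//; try exact: integrable_laplace_kernel.
    by rewrite mulrA.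
  have -> : 0 = V * (Num.sqrt 2 * laplace (a + 2^-1) 0) - 2 * laplace a 0.
    by rewrite /V divfK ?subrr// gt_eqF// mulr_gt0.
  rewrite /g -[laplace a V]mul1r !E; apply: le_Rintegral => //.
  - by have := integrableB mh (I1 0) (I2 2 0).
  - by have := integrableB mh (I1 V) (I2 1 V).
  - move=> p; rewrite /= in_itv/= andbT => p0.
    have := kernel_growth a (ltW V0) p0.
    rewrite -![V * Num.sqrt 2 * _]mulrA -!laplace_kernel_half//.
    by rewrite !mulrBr mulrCA [X in _ <= X - _ -> _]mulrCA; lra.
have g0 : g 0 <= 0 by rewrite /g mul0r sub0r oppr_le0 ltW.
have [||v] := @IVT _ g 0 V 0 (ltW V0).
- exact: continuous_subspaceT.
- by move: (g 0) (g V) g0 gV => y z y0 z0; rewrite ge_min le_max y0 z0 orbT.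
rewrite in_itv/= => /andP[v0 _] gv; exists v.
  rewrite lt_neqAle v0 andbT eq_sym; apply/eqP => vE.
  by move: gv; rewrite vE /g mul0r sub0r => /eqP; rewrite oppr_eq0 gt_eqF.
by apply/eqP; rewrite -subr_eq0; apply/eqP.
Qed.

Lemma GammaD1 a : 0 < a -> Gamma (a + 1) = a * Gamma a.
Proof.
move=> a0; have a10 : 0 < a + 1 by rewrite addr_gt0.
pose f r p := p `^ (a - 1) * expR (- (r * p)).
have mh : measurable (half : set (measurableTypeR R)) by [].
have dfr r p : 0 < p -> is_derive r 1 (f ^~ p) (- (p `^ (a + 1 - 1) * expR (- (r * p)))).
  move=> p0.
  have d2 := @is_deriveZ R R R id (- p) r 1 _ (is_derive_id r 1).
  have d3 := @is_deriveZ R R R _ (p `^ (a - 1)) r 1 _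
    (@is_derive1_comp _ (@expR R) _ r _ _ (is_derive_expR _) d2).
  have -> : f ^~ p = (p `^ (a - 1) \*: (@expR R \o (- p \*: (@id R)))).
    apply/funext => u; congr (_ * expR _).
    by rewrite /= /GRing.scale/= mulNr mulrC.
  have -> : - (p `^ (a + 1 - 1) * expR (- (r * p))) =
    p `^ (a - 1) *: (expR ((- p \*: (@id R)) r) * (- p *: 1)).
    have -> : p `^ (a + 1 - 1) = p * p `^ (a - 1) by rewrite addrK mulr_powRB1// ltW.
    have -> : (- p \*: (@id R)) r = - (r * p) by rewrite /= /GRing.scale/=; ring.
    by rewrite /GRing.scale/=; ring.
  exact: d3.
have I_1 : `](2^-1 : R), 2%R[%classic (1 : R).
  by rewrite /= in_itv/= invf_lt1// ltr1n.
have half0 r : `](2^-1 : R), 2%R[%classic r -> 0 < r.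
  by rewrite /= in_itv/= => /andP[+ _]; exact: lt_trans.
have If r : `](2^-1 : R), 2%R[%classic r -> mu.-integrable half (EFin \o f r).
  by move=> /half0 r0; exact: integrable_gamma.
have df r p : `](2^-1 : R), 2%R[%classic r -> half p -> derivable (f ^~ p) r 1.
  by move=> _; rewrite /= in_itv/= andbT => p0; have [] := dfr r p p0.
pose G p := p `^ (a + 1 - 1) * expR (- (2^-1 * p)).
have G0 p : 0 <= G p by rewrite mulr_ge0 ?powR_ge0 ?expR_ge0.
have IG : mu.-integrable half (EFin \o G) by exact: integrable_gamma.
have pf r p : 0 < p -> partial1of2 f r p = - (p `^ (a + 1 - 1) * expR (- (r * p))).
  by move=> p0; rewrite /partial1of2 derive1E; have [] := dfr r p p0.
have fG r p : `](2^-1 : R), 2%R[%classic r -> half p -> `|partial1of2 f r p| <= G p.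
  rewrite /= !in_itv/= andbT => /andP[r2 _] p0; rewrite pf// normrN.
  rewrite ger0_norm ?mulr_ge0 ?powR_ge0 ?expR_ge0//.
  by rewrite ler_wpM2l ?powR_ge0// ler_expR lerN2 ler_pM2r// ltW.
have D := differentiation_under_integral mh I_1 If df G0 IG fG.
have R1 : \int[mu]_(p in half) partial1of2 f 1 p = - Gamma (a + 1).
  transitivity (\int[mu]_(p in half) (-1 * (p `^ (a + 1 - 1) * expR (- p)))).
    apply: eq_Rintegral => p; rewrite inE/= in_itv/= andbT => p0.
    by rewrite pf// mulN1r mul1r.
  rewrite RintegralZl ?mulN1r//.
  have := integrable_gamma a10 ltr01; apply: eq_integrable => // p _.
  by rewrite /= mul1r.
have fE r : 0 < r -> \int[mu]_(p in half) f r p = r `^ (- a) * Gamma a.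
  move=> r0; rewrite /Rintegral -laplace0.
  have := laplace_scaling 0 a0 r0; rewrite mul0r.
  rewrite (_ : integral _ _ _ = \int[mu]_(p in half) (f r p)%:E)%E; last first.
    by apply: eq_integral => p _; rewrite /f mul0r add0r.
  by move=> ->.
have : derive1 (fun r => \int[mu]_(p in half) f r p) 1 = - a * Gamma a.
  rewrite derive1E (@near_eq_derive _ _ _ _ (fun r => Gamma a * r `^ (- a))); last first.
    near=> r; have r0 : 0 < r by near: r; exact: lt_nbhsr.
    by rewrite (fE r r0) mulrC.
  have [_] := @is_deriveZ R R R _ (Gamma a) 1 1 _ (@is_derive1_powR R (- a) 1 ltr01).
  by rewrite powR1 mulr1 /GRing.scale/= => ->; rewrite mulrC.
rewrite D R1 mulNr => /eqP; rewrite eqr_opp => /eqP.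
by [].
Unshelve. all: by end_near. Qed.

Lemma Gamma_gt0 a : 0 < a -> 0 < Gamma a.
Proof. by move=> a0; rewrite -laplace0 laplace_gt0. Qed.

Lemma Gamma_pochhammer a n : 0 < a -> Gamma (a + n%:R) = pochhammer a n * Gamma a.
Proof.
move=> a0; rewrite /pochhammer; elim: n => [|n ih].
  by rewrite big_ord0 addr0 mul1r.
rewrite big_ord_recr/= -natr1 addrA GammaD1; last by rewrite ltr_wpDr.
by rewrite ih mulrCA mulrA.
Qed.

End laplace_derivative.

Section exponential_parity.
Context {R : realType}.
Implicit Types y : R.

Definition even_coeff (n : nat) : R := ((2 * n)`!%:R)^-1.
Definition odd_coeff (n : nat) : R := ((2 * n).+1`!%:R)^-1.

Lemma series_exp_parity y n :
  series (exp_coeff y) (2 * n)%N =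
  \sum_(k < n) even_coeff k * (y ^+ 2) ^+ k +
  y * \sum_(k < n) odd_coeff k * (y ^+ 2) ^+ k.
Proof.
rewrite /series/= big_mkord; elim: n => [|n ih].
  by rewrite muln0 !big_ord0 mulr0 addr0.
rewrite (_ : (2 * n.+1 = (2 * n).+2)%N); last by rewrite mulnS.
rewrite !big_ord_recr/= ih /exp_coeff/= /even_coeff /odd_coeff -!exprM [y ^+ (2 * n).+1]exprS.
by ring.
Qed.

Let parityN y n :
  series (exp_coeff (- y)) (2 * n)%N =
  \sum_(k < n) even_coeff k * (y ^+ 2) ^+ k -
  y * \sum_(k < n) odd_coeff k * (y ^+ 2) ^+ k.
Proof. by rewrite series_exp_parity sqrrN mulNr. Qed.

Let cvg_series_exp2 y : series (exp_coeff y) (2 * n)%N @[n --> \oo] --> expR y.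
Proof.
have H : series (exp_coeff y) @ \oo --> expR y by exact: is_cvg_series_exp_coeff.
have H2 : (2 * n)%N @[n --> \oo] --> \oo.
  move=> A [N _ NA]; exists N => // n /= Nn; apply: NA => /=.
  by rewrite (leq_trans Nn)// leq_pmull.
exact: cvg_comp H2 H.
Qed.

Lemma cvg_even_part y :
  \sum_(k < n) even_coeff k * (y ^+ 2) ^+ k @[n --> \oo] -->
  (expR y + expR (- y)) / 2.
Proof.
have -> : (fun n => \sum_(k < n) even_coeff k * (y ^+ 2) ^+ k) =
  (fun n => (series (exp_coeff y) (2 * n)%N + series (exp_coeff (- y)) (2 * n)%N) / 2).
  by apply/funext => n; rewrite parityN series_exp_parity; field.
by apply: cvgM; [apply: cvgD; exact: cvg_series_exp2|exact: cvg_cst].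
Qed.

Lemma cvg_odd_part y : y != 0 ->
  \sum_(k < n) odd_coeff k * (y ^+ 2) ^+ k @[n --> \oo] -->
  (expR y - expR (- y)) / (2 * y).
Proof.
move=> y0.
have -> : (fun n => \sum_(k < n) odd_coeff k * (y ^+ 2) ^+ k) =
  (fun n => (series (exp_coeff y) (2 * n)%N - series (exp_coeff (- y)) (2 * n)%N) / (2 * y)).
  by apply/funext => n; rewrite parityN series_exp_parity; field.
by apply: cvgM; [apply: cvgB|exact: cvg_cst].
Qed.

Lemma even_coeff_pochhammer k :
  even_coeff k * 4 ^+ k = (pochhammer 2^-1 k * k`!%:R)^-1.
Proof.
rewrite /pochhammer /even_coeff; elim: k => [|k ih].
  by rewrite muln0 fact0 big_ord0 expr0 !mulr1.
rewrite (_ : (2 * k.+1 = (2 * k).+2)%N); last by rewrite mulnS.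
rewrite big_ord_recr/= !factS !natrM exprS.
set q := (_ `!)%:R in ih *; set P := \prod_(_ < k) _ in ih *.
have q0 : q != 0 by rewrite pnatr_eq0 -lt0n fact_gt0.
have P0 : P != 0.
  rewrite gt_eqF// prodr_gt0// => i _; by rewrite ltr_wpDr ?invr_gt0.
have k0 : k`!%:R != 0 :> R by rewrite pnatr_eq0 -lt0n fact_gt0.
have -> : 4 ^+ k = q / (P * k`!%:R) :> R.
  by rewrite -ih mulrA divff// mul1r.
rewrite -!natr1 natrM; field.
have kk : 0 <= k%:R :> R by [].
by rewrite k0 P0 q0/= !gt_eqF//; lra.
Qed.

Lemma odd_coeff_pochhammer k :
  odd_coeff k * 4 ^+ k = (pochhammer (3 / 2) k * k`!%:R)^-1.
Proof.
rewrite /pochhammer /odd_coeff; elim: k => [|k ih].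
  by rewrite muln0 fact0 big_ord0 expr0 !mulr1.
rewrite (_ : (2 * k.+1 = (2 * k).+2)%N); last by rewrite mulnS.
rewrite big_ord_recr/= (factS (2 * k).+2) (factS (2 * k).+1) (factS k) exprS.
move: ih (fact_gt0 (2 * k).+1) (fact_gt0 k).
move: ((2 * k).+1`!)%N (k`!)%N => q k' ih q_gt0 k'_gt0; rewrite !natrM.
set P := \prod_(_ < k) _ in ih *.
have q0 : q%:R != 0 :> R by rewrite pnatr_eq0 -lt0n.
have P0 : P != 0.
  by rewrite gt_eqF// prodr_gt0// => i _; rewrite ltr_wpDr ?divr_gt0.
have k0 : k'%:R != 0 :> R by rewrite pnatr_eq0 -lt0n.
have -> : 4 ^+ k = q%:R / (P * k'%:R) :> R.
  by rewrite -ih mulrA divff// mul1r.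
rewrite -!natr1 natrM. field.
have kk : 0 <= k%:R :> R by [].
by rewrite k0 P0 q0/= !gt_eqF//; lra.
Qed.

End exponential_parity.

Section kummer.
Context {R : realType}.
Local Notation mu := (@lebesgue_measure R).
Local Notation half := (`]0%R, +oo[%classic : set R).
Implicit Types (a b r p v w alpha z : R).

Let gamma_kernel b p := p `^ (b - 1) * expR (- p).

Let mgk b : measurable_fun half (gamma_kernel b).
Proof.
have -> : gamma_kernel b = laplace_kernel b 0.
  by apply/funext => p; rewrite /laplace_kernel mul0r add0r.
by apply: half_line_measurable; exact: continuous_laplace_kernel.
Qed.

Let integral_gamma_kernel b k : 0 < b ->
  (\int[mu]_(p in half) (p ^+ k * gamma_kernel b p)%:E = (pochhammer b k * Gamma b)%:E)%E.
Proof.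
move=> b0; rewrite -Gamma_pochhammer// -laplace0 -laplaceE ?ltr_wpDr//.
apply: eq_integral => p; rewrite inE/= in_itv/= andbT => p0; congr EFin.
rewrite /gamma_kernel /laplace_kernel mul0r add0r mulrA; congr (_ * _).
rewrite -powR_mulrn ?ltW// -powRD; first by congr powR; ring.
by rewrite (gt_eqF p0) implybT.
Qed.

(* Termwise integration is licit because all the terms are nonnegative. *)
Lemma cvg_gamma_series b (c : nat -> R) (H : R -> R) : 0 < b ->
  (forall k, 0 <= c k) ->
  (forall p, 0 < p -> \sum_(k < n) c k * p ^+ k @[n --> \oo] --> H p) ->
  mu.-integrable half (fun p => (gamma_kernel b p * H p)%:E) ->
  \sum_(k < n) c k * (pochhammer b k * Gamma b) @[n --> \oo] -->
  \int[mu]_(p in half) (gamma_kernel b p * H p).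
Proof.
move=> b0 c0 cH IH.
have g0 p : 0 <= gamma_kernel b p by rewrite mulr_ge0 ?powR_ge0 ?expR_ge0.
have mh : measurable (half : set (measurableTypeR R)) by [].
have pg0 k p : 0 < p -> 0 <= p ^+ k * gamma_kernel b p.
  by move=> p0; apply: mulr_ge0 => //; rewrite exprn_ge0// ltW.
have term0 k p : 0 < p -> 0 <= c k * (p ^+ k * gamma_kernel b p).
  by move=> p0; apply: mulr_ge0 => //; exact: pg0.
have mpg k : measurable_fun half (fun p => p ^+ k * gamma_kernel b p).
  by apply: measurable_funM; [exact: measurable_funX|exact: mgk].
have mterm k : measurable_fun half (fun p => c k * (p ^+ k * gamma_kernel b p)).
  by apply: measurable_funM => //; exact: mpg.
pose f n p := \sum_(k < n) c k * (p ^+ k * gamma_kernel b p).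
have mfn n : measurable_fun half (f n) by apply: measurable_sum => k; exact: mterm.
have f0 n p : 0 < p -> 0 <= f n p.
  by move=> p0; apply: sumr_ge0 => k _; exact: term0.
have intf n : (\int[mu]_(p in half) (f n p)%:E =
    (\sum_(k < n) c k * (pochhammer b k * Gamma b))%:E)%E.
  rewrite /f; under eq_integral do rewrite -sumEFin.
  rewrite ge0_integral_sum//.
  - rewrite -sumEFin; apply: eq_bigr => k _.
    under eq_integral do rewrite EFinM.
    rewrite ge0_integralZl_EFin//.
    + by rewrite integral_gamma_kernel.
    + by move=> p; rewrite /= in_itv/= andbT => p0; rewrite lee_fin pg0.
    + by apply/measurable_EFinP; exact: mpg.
  - by move=> k; apply/measurable_EFinP; exact: mterm.
  - by move=> k p; rewrite /= in_itv/= andbT => p0; rewrite lee_fin term0.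
have fH p : 0 < p -> f n p @[n --> \oo] --> gamma_kernel b p * H p.
  move=> p0; rewrite mulrC.
  have -> : (fun n => f n p) = (fun n => (\sum_(k < n) c k * p ^+ k) * gamma_kernel b p).
    by apply/funext => n; rewrite /f mulr_suml; apply: eq_bigr => k _; rewrite mulrA.
  by apply: cvgM; [exact: cH|exact: cvg_cst].
have L : (\int[mu]_(p in half) (f n p)%:E)%E @[n --> \oo] -->
    (\int[mu]_(p in half) (gamma_kernel b p * H p)%:E)%E.
  have -> : (\int[mu]_(p in half) (gamma_kernel b p * H p)%:E)%E =
      (\int[mu]_(p in half) limn (fun n => (f n p)%:E))%E.
    apply: eq_integral => p; rewrite inE/= in_itv/= andbT => p0.
    apply/esym/cvg_lim => //; apply: cvg_EFin; first exact: nearW.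
    exact: fH.
  apply: cvg_monotone_convergence => //.
  - by move=> n; apply/measurable_EFinP; exact: mfn.
  - by move=> n p; rewrite /= in_itv/= andbT => p0; rewrite lee_fin f0.
  - move=> p; rewrite /= in_itv/= andbT => p0; apply/nondecreasing_seqP => n.
    by rewrite lee_fin /f big_ord_recr/= lerDl term0.
have fin : (\int[mu]_(p in half) (gamma_kernel b p * H p)%:E)%E \is a fin_num.
  exact: integrable_fin_num.
move: L; rewrite -(fineK fin) => /fine_cvgP[_].
by under eq_fun do rewrite /= intf.
Qed.

Let kummer_lim b cc w l : Gamma b != 0 ->
  (forall k : nat, pochhammer cc k != 0) ->
  \sum_(k < n) ((pochhammer cc k * k`!%:R)^-1 * w ^+ k * (pochhammer b k * Gamma b))
    @[n --> \oo] --> l ->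
  Gamma b * kummerM b cc w = l.
Proof.
move=> Gb pc H; rewrite -[l](@mulVKf _ (Gamma b))//; congr (_ * _).
rewrite /kummerM; apply/cvg_lim => //.
have -> : series (fun n => pochhammer b n / pochhammer cc n * (w ^+ n / n`!%:R)) =
  (fun n => (Gamma b)^-1 * \sum_(k < n) ((pochhammer cc k * k`!%:R)^-1 * w ^+ k *
     (pochhammer b k * Gamma b))).
  apply/funext => n; rewrite /series/= big_mkord mulr_sumr; apply: eq_bigr => k _.
  have k0 : k`!%:R != 0 :> R by rewrite pnatr_eq0 -lt0n fact_gt0.
  by field; rewrite k0 Gb pc.
by apply: cvgM; [exact: cvg_cst|exact: H].
Qed.

Let pochhammer_neq0 b k : 0 < b -> pochhammer b k != 0.
Proof. by move=> b0; rewrite gt_eqF// prodr_gt0// => i _; rewrite ltr_wpDr. Qed.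

Let sqr_vs v p : 0 < p -> (v * Num.sqrt (2 * p)) ^+ 2 = 4 * (2^-1 * v ^+ 2) * p.
Proof.
by move=> p0; rewrite exprMn sqr_sqrtr ?mulr_ge0 ?(ltW p0)//; field.
Qed.

Lemma kummer_even a v : 0 < a ->
  Gamma a * kummerM a 2^-1 (2^-1 * v ^+ 2) = (laplace a v + laplace a (- v)) / 2.
Proof.
move=> a0; have mh : measurable (half : set (measurableTypeR R)) by [].
set w := 2^-1 * v ^+ 2.
have w0 : 0 <= w by rewrite mulr_ge0 ?sqr_ge0.
apply: kummer_lim; [by rewrite gt_eqF// Gamma_gt0|by move=> k; exact: pochhammer_neq0|].
have Hev p : 0 < p ->
  \sum_(k < n) (pochhammer 2^-1 k * k`!%:R)^-1 * w ^+ k * p ^+ k @[n --> \oo] -->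
    (expR (v * Num.sqrt (2 * p)) + expR (- (v * Num.sqrt (2 * p)))) / 2.
  move=> p0.
  have -> : (fun n => \sum_(k < n) (pochhammer 2^-1 k * k`!%:R)^-1 * w ^+ k * p ^+ k) =
      (fun n => \sum_(k < n) even_coeff k * ((v * Num.sqrt (2 * p)) ^+ 2) ^+ k).
    apply/funext => n; apply: eq_bigr => k _.
    by rewrite -even_coeff_pochhammer sqr_vs// (exprMn k _ p) (exprMn k 4 w) !mulrA.
  exact: cvg_even_part.
have E p : gamma_kernel a p * ((expR (v * Num.sqrt (2 * p)) + expR (- (v * Num.sqrt (2 * p)))) / 2)
    = 2^-1 * laplace_kernel a v p + 2^-1 * laplace_kernel a (- v) p.
  by rewrite /gamma_kernel /laplace_kernel mulNr !expRD; ring.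
have I u : mu.-integrable half (EFin \o (fun p => 2^-1 * laplace_kernel a u p)).
  exact: (integrableZl _ _ (integrable_laplace_kernel u a0)).
have <- : \int[mu]_(p in half) (gamma_kernel a p * ((expR (v * Num.sqrt (2 * p)) +
    expR (- (v * Num.sqrt (2 * p)))) / 2)) = (laplace a v + laplace a (- v)) / 2.
  under eq_Rintegral do rewrite E.
  rewrite RintegralD// !RintegralZl//; try exact: integrable_laplace_kernel.
  by rewrite /laplace; ring.
apply: (@cvg_gamma_series a (fun k => (pochhammer 2^-1 k * k`!%:R)^-1 * w ^+ k)
  (fun p => (expR (v * Num.sqrt (2 * p)) + expR (- (v * Num.sqrt (2 * p)))) / 2) a0 _ Hev).
- move=> k; rewrite mulr_ge0 ?exprn_ge0// invr_ge0 mulr_ge0//.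
  by apply: prodr_ge0 => i _; rewrite addr_ge0.
- have := integrableD mh (I v) (I (- v)).
  by apply: eq_integrable => // p _; rewrite E.
Qed.

Lemma kummer_odd a v : 0 < a -> v != 0 ->
  v * Num.sqrt 2 * Gamma (a + 2^-1) * kummerM (a + 2^-1) (3 / 2) (2^-1 * v ^+ 2) =
  (laplace a v - laplace a (- v)) / 2.
Proof.
move=> a0 v0; have a20 : 0 < a + 2^-1 by rewrite addr_gt0.
have s20 : Num.sqrt 2 != 0 :> R by rewrite gt_eqF// sqrtr_gt0.
have mh : measurable (half : set (measurableTypeR R)) by [].
set w := 2^-1 * v ^+ 2.
have w0 : 0 <= w by rewrite mulr_ge0 ?sqr_ge0.
rewrite -mulrA (@kummer_lim _ _ _ ((laplace a v - laplace a (- v)) / (2 * (v * Num.sqrt 2)))).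
- by field; rewrite v0 s20.
- by rewrite gt_eqF// Gamma_gt0.
- by move=> k; apply: pochhammer_neq0; rewrite divr_gt0.
pose H p := (expR (v * Num.sqrt (2 * p)) - expR (- (v * Num.sqrt (2 * p)))) /
  (2 * (v * Num.sqrt (2 * p))).
have sp p : 0 < p -> Num.sqrt (2 * p) != 0 by move=> p0; rewrite gt_eqF// sqrtr_gt0 mulr_gt0.
have Hod p : 0 < p ->
  \sum_(k < n) (pochhammer (3 / 2) k * k`!%:R)^-1 * w ^+ k * p ^+ k @[n --> \oo] --> H p.
  move=> p0.
  have -> : (fun n => \sum_(k < n) (pochhammer (3 / 2) k * k`!%:R)^-1 * w ^+ k * p ^+ k) =
      (fun n => \sum_(k < n) odd_coeff k * ((v * Num.sqrt (2 * p)) ^+ 2) ^+ k).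
    apply/funext => n; apply: eq_bigr => k _.
    by rewrite -odd_coeff_pochhammer sqr_vs// (exprMn k _ p) (exprMn k 4 w) !mulrA.
  by apply: cvg_odd_part; rewrite mulf_neq0 ?sp.
pose c := (2 * (v * Num.sqrt 2))^-1.
have E p : 0 < p -> gamma_kernel (a + 2^-1) p * H p
    = c * laplace_kernel a v p - c * laplace_kernel a (- v) p.
  move=> p0; rewrite /gamma_kernel /laplace_kernel /H /c mulNr !expRD sqrtrM//.
  rewrite -(powR12_sqrt (ltW p0)) (_ : a + 2^-1 - 1 = 2^-1 + (a - 1)); last by ring.
  rewrite (@powRD _ p 2^-1 (a - 1)); last by rewrite (gt_eqF p0) implybT.
  field. by rewrite v0 s20 gt_eqF ?powR_gt0.
have I u : mu.-integrable half (EFin \o (fun p => c * laplace_kernel a u p)).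
  exact: (integrableZl _ _ (integrable_laplace_kernel u a0)).
have <- : \int[mu]_(p in half) (gamma_kernel (a + 2^-1) p * H p) =
    (laplace a v - laplace a (- v)) / (2 * (v * Num.sqrt 2)).
  transitivity (\int[mu]_(p in half) (c * laplace_kernel a v p - c * laplace_kernel a (- v) p)).
    by apply: eq_Rintegral => p; rewrite inE/= in_itv/= andbT => p0; rewrite E.
  rewrite RintegralB// !RintegralZl//; try exact: integrable_laplace_kernel.
  by rewrite /laplace /c; ring.
apply: (@cvg_gamma_series (a + 2^-1) (fun k => (pochhammer (3 / 2) k * k`!%:R)^-1 * w ^+ k)
  H a20 _ Hod).
- move=> k; rewrite mulr_ge0 ?exprn_ge0// invr_ge0 mulr_ge0//.
  by apply: prodr_ge0 => i _; rewrite addr_ge0// divr_ge0.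
- have := integrableB mh (I v) (I (- v)).
  apply: eq_integrable => // p; rewrite inE/= in_itv/= andbT => p0.
  by rewrite E.
Qed.

Definition h1_const alpha : R := Num.sqrt pi / 2 `^ xi alpha /
  (Gamma (xi alpha) * Gamma (2^-1 + xi alpha)).

Lemma xi_gt0 alpha : 0 < alpha -> 0 < xi alpha.
Proof. by move=> a0; rewrite /xi invr_gt0 mulr_gt0// exprn_gt0. Qed.

Lemma h1_const_gt0 alpha : 0 < alpha -> 0 < h1_const alpha.
Proof.
move=> /xi_gt0 x0; apply: divr_gt0.
  by apply: divr_gt0; [rewrite sqrtr_gt0 pi_gt0|exact: powR_gt0].
by apply: mulr_gt0; apply: Gamma_gt0 => //; exact: addr_gt0.
Qed.

Lemma h1_laplace alpha z : 0 < alpha ->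
  h1 alpha z = h1_const alpha * laplace (xi alpha) (- z).
Proof.
move=> /xi_gt0 x0; rewrite /h1 /h1_const; set a := xi alpha in x0 *.
have G1 : Gamma a != 0 by rewrite gt_eqF// Gamma_gt0.
have G2 : Gamma (a + 2^-1) != 0 by rewrite gt_eqF// Gamma_gt0 ?addr_gt0.
rewrite ![2^-1 + a]addrC.
have He := kummer_even z x0.
have -> : kummerM a 2^-1 (2^-1 * z ^+ 2) = (laplace a z + laplace a (- z)) / 2 / Gamma a.
  by rewrite -He mulrAC divff ?mul1r.
have p2 : 2 `^ a != 0 :> R by rewrite gt_eqF// powR_gt0.
have [->|z0] := eqVneq z 0.
  rewrite !mul0r subr0 oppr0; move: G1 G2 p2.
  move: (laplace a 0) (Gamma a) (Gamma (a + 2^-1)) (2 `^ a) (Num.sqrt pi).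
  by move=> L g1 g2 p s G1 G2 p2; field; rewrite G1 G2 p2.
have Ho := kummer_odd x0 z0.
have -> : z * Num.sqrt 2 / Gamma a * kummerM (a + 2^-1) (3 / 2) (2^-1 * z ^+ 2) =
  (laplace a z - laplace a (- z)) / 2 / (Gamma a * Gamma (a + 2^-1)).
  rewrite -Ho; move: G1 G2 (kummerM _ _ _) (Num.sqrt 2).
  move: (Gamma a) (Gamma (a + 2^-1)) => g1 g2 G1 G2 k q.
  by field; rewrite G1 G2.
move: G1 G2 p2 (laplace a z) (laplace a (- z)) (Num.sqrt pi).
move: (Gamma a) (Gamma (a + 2^-1)) (2 `^ a) => g1 g2 p G1 G2 p2 L L' s.
by field; rewrite G1 G2 p2.
Qed.

Lemma is_derive_h1 alpha z : 0 < alpha ->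
  is_derive z 1 (h1 alpha)
    (- (h1_const alpha * (Num.sqrt 2 * laplace (xi alpha + 2^-1) (- z)))).
Proof.
move=> a0; have x0 := xi_gt0 a0.
have d1 := @is_derive1_comp _ (laplace (xi alpha)) -%R z _ _
  (is_derive_laplace (- z) x0) (is_deriveNid z 1).
have := @is_deriveZ R R R _ (h1_const alpha) z 1 _ d1.
have -> : h1_const alpha \*: (laplace (xi alpha) \o -%R) = h1 alpha.
  by apply/funext => y; rewrite h1_laplace.
by rewrite /GRing.scale/= mulrN1 mulrN.
Qed.

Lemma x_root_spec alpha : 0 < alpha ->
  x_root alpha < 0 /\
  - x_root alpha * (Num.sqrt 2 * laplace (xi alpha + 2^-1) (- x_root alpha)) =
  laplace (xi alpha) (- x_root alpha).
Proof.
move=> a0; have x0 := xi_gt0 a0; have c0 := h1_const_gt0 a0.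
have dh z : derive1 (h1 alpha) z =
    - (h1_const alpha * (Num.sqrt 2 * laplace (xi alpha + 2^-1) (- z))).
  by rewrite derive1E; have [] := is_derive_h1 z a0.
have spec z : z * derive1 (h1 alpha) z = h1 alpha z <->
    - z * (Num.sqrt 2 * laplace (xi alpha + 2^-1) (- z)) = laplace (xi alpha) (- z).
  rewrite dh h1_laplace// -mulrNN opprK mulrCA.
  by split=> [/(mulfI (lt0r_neq0 c0))//|->].
have [v v0 vE] := laplace_root x0.
have [r0 rE] : [set z : R | z < 0 /\ z * derive1 (h1 alpha) z = h1 alpha z] (x_root alpha).
  rewrite /x_root; apply: (@xgetPex _ 0); exists (- v); split; first by rewrite oppr_lt0.
  by apply/spec; rewrite opprK.
by split=> //; apply/spec.
Qed.

End kummer.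

(** * The value function *)

Section boundary_exponent.
Context {R : realType}.
Implicit Types (alpha l s r z : R).

Lemma beta_gt0 alpha : 0 <= alpha -> 0 < beta alpha.
Proof.
move=> a0; rewrite /beta; case: eqVneq => // an0.
have {an0} a0' : 0 < alpha by rewrite lt_neqAle eq_sym an0.
by rewrite divr_gt0// oppr_gt0; case: (x_root_spec a0').
Qed.

Lemma alpha_beta alpha : 0 < alpha -> alpha * beta alpha = - x_root alpha.
Proof.
by move=> a0; rewrite /beta gt_eqF// mulrC divfK// gt_eqF.
Qed.

Lemma pow1_cvg0 r : 0 < r -> pow1 r s @[s --> (1 : R)^'-] --> 0.
Proof.
move=> r0; apply/cvgrPdist_le => e e0.
pose m := expR (r^-1 * ln e); have m0 : 0 < m by exact: expR_gt0.
near=> s.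
have s1 : s < 1 by near: s; exact: nbhs_left_lt.
have sm : 1 - m <= s by near: s; apply: nbhs_left_ge; rewrite ltrBlDr ltrDl.
rewrite sub0r normrN ger0_norm ?(ltW (pow1_gt0 _ _))//.
have le_ln : ln (1 - s) <= r^-1 * ln e.
  rewrite -[leRHS]expRK -/m ler_ln ?posrE// ?subr_gt0//; lra.
have -> : e = expR (ln e) by rewrite lnK.
by rewrite /pow1 ler_expR -ler_pdivlMl.
Unshelve. all: by end_near. Qed.

Lemma drift_half alpha s z : s < 1 ->
  pow1 (- drift alpha) s * z = pow1 (- (alpha ^+ 2 / 2)) s * (z / Num.sqrt (1 - s)).
Proof.
move=> s1; have -> : - drift alpha = - (alpha ^+ 2 / 2) + - 2^-1.
  by rewrite /drift; field.
by rewrite pow1D (pow1N 2^-1) pow1_half// mulrAC -mulrA.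
Qed.

Let boundary_drift alpha s : s < 1 ->
  pow1 (- drift alpha) s * gamma alpha s = beta alpha * pow1 (- (alpha ^+ 2 / 2)) s.
Proof.
move=> s1; rewrite drift_half// /gamma mulfK; first by rewrite mulrC.
by rewrite gt_eqF// sqrtr_gt0 subr_gt0.
Qed.

Definition boundary_exponent alpha l s : R :=
  l * (pow1 (- drift alpha) s * gamma alpha s) - l ^+ 2 * clock alpha s / 2.

Let boundary_exponentE alpha l s : 0 < alpha -> s < 1 ->
  boundary_exponent alpha l s =
  l * beta alpha * pow1 (- (alpha ^+ 2 / 2)) s -
  (l * pow1 (- (alpha ^+ 2 / 2)) s) ^+ 2 / (2 * alpha ^+ 2).
Proof.
move=> a0 s1; rewrite /boundary_exponent boundary_drift// /clock gt_eqF//.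
rewrite exprMn pow1_sqr (_ : 2 * - (alpha ^+ 2 / 2) = - alpha ^+ 2); last by field.
by field; rewrite gt_eqF.
Qed.

Lemma boundary_exponent_bounded alpha l : 0 <= alpha -> 0 < l ->
  exists C, forall s, 0 <= s < 1 -> boundary_exponent alpha l s <= C.
Proof.
rewrite le_eqVlt => /predU1P[<-|a0] l0.
  exists (l * beta 0) => s /andP[s0 s1].
  rewrite /boundary_exponent boundary_drift// expr0n/= mul0r oppr0 pow1_0 mulr1.
  rewrite lerBlDr lerDl divr_ge0// mulr_ge0 ?sqr_ge0// /clock eqxx oppr_ge0.
  by rewrite ln_le0//; lra.
exists (alpha ^+ 2 * beta alpha ^+ 2 / 2) => s /andP[_ s1].
rewrite boundary_exponentE//; set q := pow1 _ _.
have := sqr_ge0 (l * q / alpha - alpha * beta alpha).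
have -> : (l * q / alpha - alpha * beta alpha) ^+ 2 =
  2 * ((l * q) ^+ 2 / (2 * alpha ^+ 2)) - 2 * (l * beta alpha * q) +
  2 * (alpha ^+ 2 * beta alpha ^+ 2 / 2).
  by field; rewrite gt_eqF.
lra.
Qed.

Lemma boundary_exponent_cvg alpha l : 0 <= alpha -> 0 < l ->
  expR (boundary_exponent alpha l s) @[s --> (1 : R)^'-] --> 0.
Proof.
rewrite le_eqVlt => /predU1P[<-|a0] l0.
  have c0 : expR (l * beta 0) * pow1 (l ^+ 2 / 2) s @[s --> (1 : R)^'-] --> 0.
    rewrite -[X in _ --> X](mulr0 (expR (l * beta 0))).
    apply: cvgM; first exact: cvg_cst.
    by apply: pow1_cvg0; rewrite divr_gt0// exprn_gt0.
  apply: cvg_trans c0; apply: near_eq_cvg; near=> s.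
  have s1 : s < 1 by near: s; exact: nbhs_left_lt.
  rewrite /boundary_exponent boundary_drift// expr0n/= mul0r oppr0 pow1_0 mulr1.
  rewrite /clock eqxx /pow1 -expRD; congr expR; by field.
have lb0 : 0 < l * beta alpha by apply: mulr_gt0 => //; apply: beta_gt0; exact: ltW.
pose K := expR (2 * alpha ^+ 2 * beta alpha ^+ 2) / (l * beta alpha).
have c0 : K * pow1 (alpha ^+ 2 / 2) s @[s --> (1 : R)^'-] --> 0.
  rewrite -[X in _ --> X](mulr0 K); apply: cvgM; first exact: cvg_cst.
  by apply: pow1_cvg0; rewrite divr_gt0// exprn_gt0.
apply: (squeeze_cvgr _ (cvg_cst 0) c0); near=> s.
have s1 : s < 1 by near: s; exact: nbhs_left_lt.
rewrite expR_ge0/= boundary_exponentE//.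
have -> : pow1 (alpha ^+ 2 / 2) s = (pow1 (- (alpha ^+ 2 / 2)) s)^-1.
  by rewrite -pow1N opprK.
set q := pow1 _ _; have q0 : 0 < q by exact: pow1_gt0.
have lbq : 0 < l * beta alpha * q by rewrite mulr_gt0.
have bound : l * beta alpha * q - (l * q) ^+ 2 / (2 * alpha ^+ 2) <=
    2 * alpha ^+ 2 * beta alpha ^+ 2 - l * beta alpha * q.
  have := sqr_ge0 (l * q / alpha - 2 * alpha * beta alpha).
  have -> : (l * q / alpha - 2 * alpha * beta alpha) ^+ 2 =
    2 * ((l * q) ^+ 2 / (2 * alpha ^+ 2)) - 4 * (l * beta alpha * q) +
    2 * (2 * alpha ^+ 2 * beta alpha ^+ 2).
    by field; rewrite gt_eqF.
  lra.
apply: (@le_trans _ _ (expR (2 * alpha ^+ 2 * beta alpha ^+ 2 - l * beta alpha * q))).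
  by rewrite ler_expR.
rewrite expRD expRN /K -!mulrA ler_wpM2l ?expR_ge0// -invfM lef_pV2 ?posrE ?expR_gt0//.
  by apply: le_trans (expR_ge1Dx _); rewrite mulrA lerDr.
Unshelve. all: by end_near. Qed.

End boundary_exponent.

Section mixture.
Local Open Scope ereal_scope.
Context d (T : measurableType d) (R : realType) (P : probability T R).
Local Notation mu := (@lebesgue_measure R).
Local Notation half := (`]0%R, +oo[%classic : set R).

Lemma tonelli_half_line (F : T -> R -> R) :
  measurable_fun setT (fun z : T * measurableTypeR R => F z.1 z.2) ->
  (forall w p, (0 <= F w p)%R) ->
  \int[P]_w \int[mu]_(p in half) (F w p)%:E =
  \int[mu]_(p in half) \int[P]_w (F w p)%:E.
Proof.
move=> mF F0.
have mh : measurable (half : set (measurableTypeR R)) by [].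
pose G (z : T * measurableTypeR R) : \bar R := (F z.1 z.2 * \1_half z.2)%:E.
have mG : measurable_fun setT G.
  apply/measurable_EFinP; apply: measurable_funM => //.
  apply: (@measurableT_comp _ _ _ _ _ _ (\1_half : measurableTypeR R -> R) _ snd) => //.
have G0 z : 0 <= G z by rewrite lee_fin mulr_ge0.
have := @fubini_tonelli _ _ T (measurableTypeR R) R P mu G mG G0.
have -> : \int[P]_x \int[mu]_y G (x, y) = \int[P]_w \int[mu]_(p in half) (F w p)%:E.
  apply: eq_integral => w _; rewrite [RHS]integral_mkcond; apply: eq_integral => p _.
  by rewrite /G/= patchE indicE; case: ifP => _; rewrite ?mulr1 ?mulr0.
move=> ->; rewrite [RHS]integral_mkcond; apply: eq_integral => p _.
rewrite patchE; case: ifP => ph.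
  by apply: eq_integral => w _; rewrite /G/= indicE ph mulr1.
rewrite -[RHS](integral0 P setT); apply: eq_integral => w _.
by rewrite /G/= indicE ph mulr0.
Qed.

End mixture.

Section candidate.
Context {R : realType}.
Local Notation mu := (@lebesgue_measure R).
Local Notation half := (`]0%R, +oo[%classic : set R).
Implicit Types (alpha l s z p D : R).

Definition candidate alpha s z : R :=
  if alpha == 0 then Num.sqrt (1 - s) * expR (z / Num.sqrt (1 - s) - 1)
  else beta alpha / laplace (xi alpha) (alpha * beta alpha) *
    (Num.sqrt (1 - s) * laplace (xi alpha) (alpha * z / Num.sqrt (1 - s))).

Let sqrt1_gt0 s : s < 1 -> 0 < Num.sqrt (1 - s).
Proof. by move=> s1; rewrite sqrtr_gt0 subr_gt0. Qed.

Let alpha_gt0 alpha : 0 <= alpha -> alpha != 0 -> 0 < alpha.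
Proof. by move=> a0 an0; rewrite lt_neqAle eq_sym an0. Qed.

Lemma candidate_ge0 alpha s z : 0 <= alpha -> 0 <= candidate alpha s z.
Proof.
move=> a0; rewrite /candidate; case: eqVneq => [_|/(alpha_gt0 a0) a0'].
  by rewrite mulr_ge0 ?expR_ge0.
apply: mulr_ge0; first by rewrite divr_ge0 ?(ltW (beta_gt0 a0))// ltW// laplace_gt0// xi_gt0.
by rewrite mulr_ge0// ltW// laplace_gt0// xi_gt0.
Qed.

(* Smooth fit: the defining equation of the root says that the tangent at
   [alpha * beta alpha] goes through the origin. *)
Lemma le_candidate alpha s z : 0 <= alpha -> s < 1 -> z <= candidate alpha s z.
Proof.
move=> a0 s1; have q0 := sqrt1_gt0 s1.
rewrite /candidate; set q := Num.sqrt _ in q0 *.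
case: eqVneq => [_|/(alpha_gt0 a0) a0'].
  have := expR_ge1Dx (z / q - 1); rewrite addrC subrK => H.
  by rewrite -[leLHS](divfK (lt0r_neq0 q0)) mulrC ler_pM2l.
have x0 := xi_gt0 a0'; have b0 := beta_gt0 a0.
set v := alpha * beta alpha; have v0 : 0 < v by rewrite mulr_gt0.
have L0 := laplace_gt0 v x0.
have := laplace_tangent (alpha * z / q) v x0.
have [_] := x_root_spec a0'; rewrite -alpha_beta// -/v => rootE.
have -> : laplace (xi alpha) v + Num.sqrt 2 * laplace (xi alpha + 2^-1) v *
    (alpha * z / q - v) = laplace (xi alpha) v * (alpha * z / q) / v.
  by rewrite -rootE; field; rewrite !gt_eqF.
move=> H; apply: (@le_trans _ _ (beta alpha / laplace (xi alpha) v *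
    (q * (laplace (xi alpha) v * (alpha * z / q) / v)))).
  rewrite (_ : _ * (q * _) = z)// /v.
  by field; rewrite !gt_eqF.
rewrite ler_wpM2l ?divr_ge0 ?(ltW b0) ?(ltW L0)//.
by rewrite ler_wpM2l// ltW.
Qed.

Lemma candidate_gamma alpha s : 0 <= alpha -> s < 1 ->
  candidate alpha s (gamma alpha s) = gamma alpha s.
Proof.
move=> a0 s1; have q0 := sqrt1_gt0 s1; rewrite /candidate /gamma.
case: eqVneq => [->|/(alpha_gt0 a0) a0'].
  by rewrite /beta eqxx mul1r divff ?gt_eqF// subrr expR0 mulr1.
have L0 := laplace_gt0 (alpha * beta alpha) (xi_gt0 a0').
have -> : alpha * (beta alpha * Num.sqrt (1 - s)) / Num.sqrt (1 - s) =
  alpha * beta alpha by field; rewrite gt_eqF.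
by move: (laplace _ _) L0 => L L0; field; rewrite gt_eqF.
Qed.

Lemma candidate_quotient alpha s z : 0 <= alpha -> s < 1 ->
  candidate alpha s z = h1_quotient alpha (z / gamma alpha s) * gamma alpha s.
Proof.
move=> a0 s1; have q0 := sqrt1_gt0 s1; rewrite /candidate /h1_quotient /gamma.
case: eqVneq => [->|/(alpha_gt0 a0) a0'].
  by rewrite /beta eqxx !mul1r mulrC.
have x0 := xi_gt0 a0'; have c0 := h1_const_gt0 a0'; have b0 := beta_gt0 a0.
rewrite !h1_laplace// mulNr mulNr !opprK.
have -> : alpha * beta alpha * (z / (beta alpha * Num.sqrt (1 - s))) =
    alpha * z / Num.sqrt (1 - s) by field; rewrite !gt_eqF.
have L0 := laplace_gt0 (alpha * beta alpha) x0.
by field; rewrite !gt_eqF.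
Qed.

Definition exponent alpha p : R := alpha * Num.sqrt (2 * p).

Lemma candidate0E s z : s < 1 -> candidate 0 s z =
  expR (-1) * expR (1 * (pow1 (- drift 0) s * z) - 1 ^+ 2 * clock 0 s / 2).
Proof.
move=> s1; rewrite /candidate /clock eqxx -expRD -pow1_half//.
have -> : pow1 (- drift 0) s = (pow1 2^-1 s)^-1.
  rewrite -pow1N; have -> // : - drift 0 = - 2^-1 :> R.
  by rewrite /drift; field.
rewrite {1}/pow1 -expRD; congr expR; by field; rewrite gt_eqF// pow1_gt0.
Qed.

Lemma candidate_mixture alpha s z : 0 < alpha -> s < 1 ->
  (candidate alpha s z)%:E =
  ((beta alpha / laplace (xi alpha) (alpha * beta alpha))%:E *
   \int[mu]_(p in half) (p `^ (xi alpha - 1) *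
     expR (exponent alpha p * (pow1 (- drift alpha) s * z) -
           exponent alpha p ^+ 2 * clock alpha s / 2))%:E)%E.
Proof.
move=> a0 s1; have x0 := xi_gt0 a0; have q0 := sqrt1_gt0 s1.
rewrite /candidate gt_eqF// EFinM; congr (_ * _)%E.
set r := pow1 (- alpha ^+ 2) s; have r0 : 0 < r by exact: pow1_gt0.
have sr : Num.sqrt r = pow1 (- (alpha ^+ 2 / 2)) s.
  rewrite /r (_ : - alpha ^+ 2 = 2 * - (alpha ^+ 2 / 2)); last by field.
  by rewrite -pow1_sqr sqrtr_sqr gtr0_norm// pow1_gt0.
transitivity (\int[mu]_(p in half) (p `^ (xi alpha - 1) *
    expR (alpha * (pow1 (- drift alpha) s * z) * Num.sqrt (2 * p) - r * p))%:E)%E.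
  rewrite (laplace_scaling (alpha * (pow1 (- drift alpha) s * z)) x0 r0).
  apply: (congr1 EFin).
  have -> : r `^ (- xi alpha) = Num.sqrt (1 - s).
    rewrite /powR gt_eqF// /r /pow1 expRK -pow1_half// /pow1; congr expR.
    by rewrite /xi; field; rewrite gt_eqF.
  congr (_ * laplace _ _); rewrite drift_half// sr; field.
  by rewrite !gt_eqF// pow1_gt0.
apply: eq_integral => p; rewrite inE/= in_itv/= andbT => p0.
congr (_ * expR _)%:E; rewrite /clock gt_eqF// /exponent -/r exprMn sqr_sqrtr.
  by field; rewrite gt_eqF.
by rewrite mulr_ge0// ltW.
Qed.

Lemma exponent_gt0 alpha p : 0 < alpha -> 0 < p -> 0 < exponent alpha p.
Proof. by move=> a0 p0; rewrite mulr_gt0// sqrtr_gt0 mulr_gt0. Qed.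

End candidate.

Section candidate_stopping.
Context d (T : measurableType d) (R : realType) (P : probability T R).
Context (B : R -> T -> R) (hB : standard_brownian_motion P B).
Context (alpha : R) (halpha : 0 <= alpha).
Context (t : R) (ht : 0 <= t < 1) (x : R).
Context (X : R -> T -> R) (hX : sde_solution P alpha B t x X).
Context (tau : T -> R) (stau : stopping_time B t tau).
Local Notation mu := (@lebesgue_measure R).
Local Notation half := (`]0%R, +oo[%classic : set R).

Let t1 : t < 1. Proof. by case/andP: ht. Qed.

Let mtau : measurable_fun setT tau.
Proof.
have /andP[t0 _] := ht.
apply: (@stopping_time_measurable _ _ _ B _ t) => //.
by move=> s s0; exact: (brownian_measurable hB).
Qed.

Let mlt1 : measurable_fun setT (fun w => tau w < 1).
Proof. by apply: measurable_fun_ltr. Qed.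

Let mX : measurable_fun setT (fun w => X (tau w) w).
Proof. exact (measurable_bridge_value hB ht hX stau). Qed.

Let mpow p : measurable_fun setT (fun w => pow1 p (tau w)).
Proof.
rewrite /pow1; apply: measurableT_comp => //; apply: measurable_funM => //.
by apply: measurableT_comp => //; exact: measurable_funB.
Qed.

Let mclock : measurable_fun setT (fun w => clock alpha (tau w)).
Proof.
rewrite /clock; case: (alpha == 0).
  apply: measurableT_comp => //; apply: measurableT_comp => //.
  exact: measurable_funB.
by apply: measurable_funM => //; exact: mpow.
Qed.

(* [D] is the amount by which the martingale [pow1 (- drift alpha) s * X s] is
   shifted, i.e. the starting point is moved by [D * pow1 (drift alpha) t]. *)
Definition shifted D s w : R := X s w - D * pow1 (drift alpha) s.

Definition stopped_candidate D w : R :=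
  if tau w < 1 then candidate alpha (tau w) (shifted D (tau w) w) else 0.

Let stopped_exp l D w : R :=
  if tau w < 1 then exp_martingale alpha X l D (tau w) w else 0.

Let exp_martingale_shifted l D s w :
  exp_martingale alpha X l D s w =
  expR (l * (pow1 (- drift alpha) s * shifted D s w) - l ^+ 2 * clock alpha s / 2).
Proof.
have -> : pow1 (- drift alpha) s * shifted D s w =
    pow1 (- drift alpha) s * X s w - D.
  by rewrite /shifted mulrBr (mulrCA _ D) -pow1D addNr pow1_0 mulr1.
by [].
Qed.

Let stopped_exp_ge0 l D w : 0 <= stopped_exp l D w.
Proof. by rewrite /stopped_exp; case: ifP => // _; exact: expR_ge0. Qed.

Lemma measurable_stopped_candidate D : measurable_fun setT (stopped_candidate D).
Proof.
have msh : measurable_fun setT (fun w => shifted D (tau w) w).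
  by apply: measurable_funB => //; apply: measurable_funM => //; exact: mpow.
rewrite (_ : stopped_candidate D = fun w => if tau w < 1 then
    (if alpha == 0 then pow1 2^-1 (tau w) *
       expR (shifted D (tau w) w * pow1 (- 2^-1) (tau w) - 1)
     else beta alpha / laplace (xi alpha) (alpha * beta alpha) *
       (pow1 2^-1 (tau w) * laplace (xi alpha)
          (alpha * shifted D (tau w) w * pow1 (- 2^-1) (tau w)))) else 0); last first.
  apply/funext => w; rewrite /stopped_candidate; case: ifPn => [tau1|]; last by [].
  by rewrite /candidate pow1N pow1_half.
apply: measurable_fun_ifT => //; case: eqVneq => [_|an0].
  apply: measurable_funM => //; apply: measurableT_comp => //.
  by apply: measurable_funB => //; apply: measurable_funM => //; exact: mpow.
have a0 : 0 < alpha by rewrite lt_neqAle eq_sym an0.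
apply: measurable_funM => //; apply: measurable_funM => //.
apply: (@measurableT_comp _ _ _ _ _ _ (laplace (xi alpha))).
  by apply: continuous_measurable_fun; apply: continuous_laplace; exact: xi_gt0.
apply: measurable_funM; last exact: mpow.
exact: measurable_funM.
Qed.

Let joint D (w : T) (p : R) : R := p `^ (xi alpha - 1) * stopped_exp (exponent alpha p) D w.

Let joint_ge0 D w p : 0 <= joint D w p.
Proof. by rewrite mulr_ge0 ?powR_ge0. Qed.

Let mjoint D : measurable_fun setT (fun z : T * measurableTypeR R => joint D z.1 z.2).
Proof.
have comp1 (dU : measure_display) (U : measurableType dU) (f : T -> U) :
    measurable_fun setT f -> measurable_fun setT (fun z : T * measurableTypeR R => f z.1).
  by move=> mf; exact: (measurableT_comp mf measurable_fst).
have comp2 (f : R -> R) : measurable_fun setT f ->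
    measurable_fun setT (fun z : T * measurableTypeR R => f z.2).
  by move=> mf; apply: (@measurableT_comp _ _ _ _ _ _ (f : measurableTypeR R -> R)) => //.
have mexp : measurable_fun setT (fun z : T * measurableTypeR R => exponent alpha z.2).
  apply: (comp2 (fun p => exponent alpha p)); apply: measurable_funM => //.
  apply: measurableT_comp; last exact: measurable_funM.
  by apply: continuous_measurable_fun; exact: sqrt_continuous.
apply: measurable_funM; 
  first by apply: (comp2 (fun p => p `^ (xi alpha - 1))); exact: measurable_powR.
apply: measurable_fun_ifT => //; first exact: comp1 mlt1.
apply: measurableT_comp => //; apply: measurable_funB.
  apply: measurable_funM => //; apply: measurable_funB => //.
  apply: (comp1 _ _ (fun w => pow1 (- drift alpha) (tau w) * X (tau w) w)).
  exact: measurable_funM.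
apply: measurable_funM => //; apply: measurable_funM; first exact: measurable_funX.
exact: (comp1 _ _ _ mclock).
Qed.

Let k0 := beta alpha / laplace (xi alpha) (alpha * beta alpha).

Let integral_candidate_pos D : 0 < alpha ->
  (\int[P]_w (stopped_candidate D w)%:E = k0%:E *
   \int[mu]_(p in half) ((p `^ (xi alpha - 1))%:E *
      \int[P]_w (stopped_exp (exponent alpha p) D w)%:E))%E.
Proof.
move=> a0; have x0 := xi_gt0 a0.
have k00 : 0 <= k0.
  by rewrite divr_ge0 ?(ltW (beta_gt0 halpha))// ltW// laplace_gt0.
have mh : measurable (half : set (measurableTypeR R)) by [].
transitivity (\int[P]_w (k0%:E * \int[mu]_(p in half) (joint D w p)%:E))%E.
  apply: eq_integral => w _; rewrite /stopped_candidate /joint /stopped_exp.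
  case: ifPn => [tau1|_].
    rewrite candidate_mixture//; congr (_ * _)%E; apply: eq_integral => p _.
    by rewrite exp_martingale_shifted.
  by under eq_integral do rewrite mulr0; rewrite integral0 mule0.
rewrite ge0_integralZl_EFin//.
- congr (_ * _)%E; rewrite (@tonelli_half_line _ _ _ P (joint D) (mjoint D) (joint_ge0 D)).
  apply: eq_integral => p _; rewrite /joint.
  under eq_integral do rewrite EFinM.
  rewrite ge0_integralZl_EFin ?powR_ge0//.
    by move=> w _; rewrite lee_fin.
  apply/measurable_EFinP.
  exact (measurable_exp_martingale_stopped hB ht hX stau (exponent alpha p) D).
- by move=> w _; apply: integral_ge0 => p _; rewrite lee_fin.
- under eq_fun do rewrite integral_mkcond.
  have := @measurable_fun_fubini_tonelli_F _ _ T (measurableTypeR R) R mu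
    (fun z => (joint D z.1 z.2 * \1_half z.2)%:E).
  rewrite /fubini_F => H.
  rewrite (_ : (fun w => _) = (fun w => \int[mu]_p (joint D w p * \1_half p)%:E)%E).
    apply: H.
      apply/measurable_EFinP; apply: measurable_funM; first exact: mjoint.
      by apply: (@measurableT_comp _ _ _ _ _ _ (\1_half : measurableTypeR R -> R) _ snd) => //.
    by move=> z; rewrite lee_fin mulr_ge0.
  apply/funext => w; apply: eq_integral => p _.
  by rewrite patchE indicE; case: ifP => _; rewrite ?mulr1 ?mulr0.
Qed.

Let m_inner D : measurable_fun half (fun p => ((p `^ (xi alpha - 1))%:E *
      \int[P]_w (stopped_exp (exponent alpha p) D w)%:E)%E).
Proof.
have := @measurable_fun_fubini_tonelli_G _ _ T (measurableTypeR R) R P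
    (fun z => (joint D z.1 z.2)%:E).
rewrite /fubini_G => H.
rewrite (_ : (fun p => _) = (fun p => \int[P]_w (joint D w p)%:E)%E).
  apply: measurable_funTS; apply: H; first by apply/measurable_EFinP; exact: mjoint.
  by move=> z; rewrite lee_fin.
apply/funext => p; rewrite /joint; under [RHS]eq_integral do rewrite EFinM.
rewrite ge0_integralZl_EFin ?powR_ge0//.
  by move=> w _; rewrite lee_fin.
apply/measurable_EFinP.
exact (measurable_exp_martingale_stopped hB ht hX stau (exponent alpha p) D).
Qed.

Let x_shift D l : l * (pow1 (- drift alpha) t * x - D) =
  l * (pow1 (- drift alpha) t * (x - D * pow1 (drift alpha) t)).
Proof.
congr (l * _).
by rewrite mulrBr (mulrCA _ D) -pow1D addNr pow1_0 mulr1.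
Qed.

Lemma stopped_candidate_le D : (\int[P]_w (stopped_candidate D w)%:E <=
  (candidate alpha t (x - D * pow1 (drift alpha) t))%:E)%E.
Proof.
have E l := exp_martingale_stopped_le hB ht hX stau l D.
have [a0|an0] := eqVneq alpha 0.
  have -> : (\int[P]_w (stopped_candidate D w)%:E =
      (expR (-1))%:E * \int[P]_w (stopped_exp 1 D w)%:E)%E.
    rewrite -ge0_integralZl_EFin ?expR_ge0//.
    - apply: eq_integral => w _; rewrite -EFinM; congr EFin.
      rewrite /stopped_candidate /stopped_exp; case: ifPn => tau1; last by rewrite mulr0.
      by rewrite exp_martingale_shifted a0 candidate0E.
    - by move=> w _; rewrite lee_fin.
    - apply/measurable_EFinP.
      exact (measurable_exp_martingale_stopped hB ht hX stau 1 D).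
  apply: (@le_trans _ _ ((expR (-1))%:E * (expR (1 * (pow1 (- drift alpha) t * x - D) -
      1 ^+ 2 * clock alpha t / 2))%:E)%E).
    by rewrite lee_wpmul2l ?lee_fin ?expR_ge0//; exact: E.
  by rewrite x_shift a0 candidate0E// -EFinM.
have a0 : 0 < alpha by rewrite lt_neqAle eq_sym an0.
have k00 : 0 <= k0.
  by rewrite divr_ge0 ?(ltW (beta_gt0 halpha))// ltW// laplace_gt0// xi_gt0.
rewrite integral_candidate_pos// candidate_mixture// lee_wpmul2l ?lee_fin//.
apply: ge0_le_integral => //.
- move=> p _; rewrite mule_ge0 ?lee_fin ?powR_ge0//.
  by apply: integral_ge0 => w _; rewrite lee_fin.
- exact: m_inner.
- apply/measurable_EFinP; apply: measurable_funTS; apply: measurable_funM.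
    exact: measurable_powR.
  apply: measurableT_comp => //.
  have mexp : measurable_fun setT (fun p : measurableTypeR R => exponent alpha p).
    apply: measurable_funM => //; apply: measurableT_comp; last exact: measurable_funM.
    by apply: continuous_measurable_fun; exact: sqrt_continuous.
  apply: measurable_funB; first exact: measurable_funM.
  by apply: measurable_funM => //; apply: measurable_funM => //; exact: measurable_funX.
- move=> p _; rewrite [in leRHS]EFinM lee_wpmul2l ?lee_fin ?powR_ge0//.
  by rewrite -x_shift; exact: E.
Qed.

(* Before the hitting time the exponential martingales are bounded, so that
   stopping them does not lose mass. *)
Lemma stopped_candidate_eq :
  {ae P, forall w s, t <= s -> s <= tau w -> s < 1 -> X s w <= gamma alpha s} ->
  (\int[P]_w (stopped_candidate 0 w)%:E = (candidate alpha t x)%:E)%E.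
Proof.
move=> Xg; have /andP[t0 _] := ht.
have E l : 0 < l -> (\int[P]_w (stopped_exp l 0 w)%:E = (expR (l *
    (pow1 (- drift alpha) t * x) - l ^+ 2 * clock alpha t / 2))%:E)%E.
  move=> l0; have [C HC] := boundary_exponent_bounded halpha l0.
  apply: (exp_martingale_stopped_eq hB ht hX stau l0 Xg (C := C)).
    by move=> s /andP[ts s1]; apply: HC; rewrite (le_trans t0 ts).
  exact: boundary_exponent_cvg.
have [a0|an0] := eqVneq alpha 0.
  have -> : (\int[P]_w (stopped_candidate 0 w)%:E =
      (expR (-1))%:E * \int[P]_w (stopped_exp 1 0 w)%:E)%E.
    rewrite -ge0_integralZl_EFin ?expR_ge0//.
    - apply: eq_integral => w _; rewrite -EFinM; congr EFin.
      rewrite /stopped_candidate /stopped_exp; case: ifPn => tau1; last by rewrite mulr0.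
      by rewrite exp_martingale_shifted a0 candidate0E.
    - by move=> w _; rewrite lee_fin.
    - apply/measurable_EFinP.
      exact (measurable_exp_martingale_stopped hB ht hX stau 1 0).
  by rewrite E// a0 candidate0E// -EFinM.
have a0 : 0 < alpha by rewrite lt_neqAle eq_sym an0.
rewrite integral_candidate_pos// candidate_mixture//; congr (_ * _)%E.
apply: eq_integral => p; rewrite inE/= in_itv/= andbT => p0.
by rewrite E ?exponent_gt0// -EFinM.
Qed.

End candidate_stopping.

Section optimal_value.
Context d (T : measurableType d) (R : realType) (P : probability T R).
Context (B : R -> T -> R) (hB : standard_brownian_motion P B).
Context (alpha : R) (halpha : 0 <= alpha).
Context (t : R) (ht : 0 <= t < 1) (x : R).
Context (X : R -> T -> R) (hX : sde_solution P alpha B t x X).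

Let t0 : 0 <= t. Proof. by case/andP: ht. Qed.
Let t1 : t < 1. Proof. by case/andP: ht. Qed.

Lemma le_integral_majorant (f g : T -> R) : (forall w, f w <= g w) ->
  (forall w, 0 <= g w) -> measurable_fun setT f -> measurable_fun setT g ->
  (\int[P]_w (f w)%:E <= \int[P]_w (g w)%:E)%E.
Proof.
move=> fg g0 mf mg; rewrite integralE.
apply: (@le_trans _ _ (\int[P]_w (EFin \o f)^\+ w)%E).
  by rewrite geeDl ?oppe_le0 ?integral_ge0.
apply: ge0_le_integral => //.
- by apply: measurable_funepos; exact/measurable_EFinP.
- exact/measurable_EFinP.
- by move=> w _; rewrite funeposE ge_max !lee_fin fg g0.
Qed.

Lemma stopped_mean_le tau D : 0 <= D -> stopping_time B t tau ->
  (stopped_mean P X tau <= (candidate alpha t (x - D * pow1 (drift alpha) t) +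
    D * pow1 (drift alpha) t)%:E)%E.
Proof.
move=> D0 stau; rewrite /stopped_mean unlock.
have c0 : 0 <= D * pow1 (drift alpha) t by rewrite mulr_ge0// ltW// pow1_gt0.
have mX := measurable_bridge_value hB ht hX stau.
have mc := measurable_stopped_candidate hB halpha ht hX stau D.
have sc0 w : 0 <= stopped_candidate alpha X tau D w.
  by rewrite /stopped_candidate; case: ifP => // _; exact: candidate_ge0.
apply: (@le_trans _ _ (\int[P]_w (stopped_candidate alpha X tau D w +
    D * pow1 (drift alpha) t)%:E)%E).
  apply: le_integral_majorant => //.
  - move=> w; have [/(_ w)/andP[ttau tau1] _] := stau.
    rewrite /stopped_candidate; case: ifPn => [tau1'|].
      have H := le_candidate (shifted alpha X D (tau w) w) halpha tau1'.
      rewrite -lerBlDr (le_trans _ H)// /shifted lerD2l lerN2 ler_wpM2l//.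
      rewrite /pow1 ler_expR ler_pM2l; last first.
        by rewrite /drift divr_gt0// ltr_wpDr ?sqr_ge0.
      by rewrite ler_ln ?posrE ?subr_gt0//; lra.
    rewrite -leNgt => tau1'; have -> : tau w = 1 by apply/le_anti; rewrite tau1.
    by have [_ _ _ ->] := hX; rewrite add0r.
  - by move=> w; rewrite addr_ge0.
  - exact: measurable_funD.
under eq_integral do rewrite EFinD.
rewrite ge0_integralD//.
- rewrite integral_cst//= probability_setT mule1 EFinD leeD2r//.
  exact (stopped_candidate_le hB halpha ht hX stau D).
- by move=> w _; rewrite lee_fin.
- exact/measurable_EFinP.
Qed.

Lemma stopped_mean_le_value tau : stopping_time B t tau ->
  (stopped_mean P X tau <=
    (if x < gamma alpha t then candidate alpha t x else x)%:E)%E.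
Proof.
move=> stau; case: ifPn => [_|].
  by have := stopped_mean_le (lexx 0) stau; rewrite mul0r subr0 addr0.
rewrite -leNgt => gx.
have p0 := pow1_gt0 (drift alpha) t.
have D0 : 0 <= (x - gamma alpha t) / pow1 (drift alpha) t.
  by rewrite divr_ge0 ?subr_ge0// ltW.
have := stopped_mean_le D0 stau; rewrite divfK ?gt_eqF//.
by rewrite subKr candidate_gamma// addrC subrK.
Qed.

Lemma stopped_mean_hitting_time :
  stopped_mean P X (hitting_time alpha X t) =
    (if x < gamma alpha t then candidate alpha t x else x)%:E.
Proof.
have stau := hitting_time_stopping_time ht hX.
have Xt := bridge_start ht hX.
have mX := measurable_bridge_value hB ht hX stau.
rewrite /stopped_mean unlock; case: ifPn => [xg|].
  have mc := measurable_stopped_candidate hB halpha ht hX stau 0.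
  rewrite -(stopped_candidate_eq hB halpha ht hX stau).
    apply: ae_eq_integral => //; try exact/measurable_EFinP.
    apply: filterS Xt => w Xt _; congr EFin; rewrite /stopped_candidate.
    have /andP[_ tau1] := hitting_time_bounds ht hX w.
    case: ifPn => [tau1'|].
      rewrite /shifted mul0r subr0 (hitting_time_eq_gamma ht hX) ?Xt//.
      by rewrite candidate_gamma.
    rewrite -leNgt => tau1'.
    have -> : hitting_time alpha X t w = 1 by apply/le_anti; rewrite tau1.
    by have [_ _ _ ->] := hX.
  apply: filterS Xt => w Xt s ts; rewrite le_eqVlt => /predU1P[->|stau'] s1.
    by rewrite (hitting_time_eq_gamma ht hX) ?Xt.
  by rewrite ltW// (before_hitting_time ht hX).
rewrite -leNgt => gx.
transitivity (\int[P]_w x%:E)%E; last first.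
  by rewrite integral_cst//= probability_setT mule1.
apply: ae_eq_integral => //; first exact/measurable_EFinP.
apply: filterS Xt => w Xt _; congr EFin.
have /andP[ttau _] := hitting_time_bounds ht hX w.
have -> : hitting_time alpha X t w = t.
  apply/le_anti; rewrite ttau andbT; apply: (hitting_time_le ht hX).
    by rewrite lexx ltW.
  by rewrite Xt.
exact: Xt.
Qed.

End optimal_value.

Theorem mainTheorem2 (d : measure_display) (T : measurableType d)
    (R : realType) (P : probability T R) (B : R -> T -> R)
    (hB : standard_brownian_motion P B)
    (alpha : R) (halpha : 0 <= alpha)
    (t : R) (ht : 0 <= t < 1) (x : R)
    (X : R -> T -> R) (hX : sde_solution P alpha B t x X) :
  [/\ stopping_time B t (hitting_time alpha X t),
      stopping_value P B X t = stopped_mean P X (hitting_time alpha X t)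
    & stopping_value P B X t =
        (if x < gamma alpha t
         then h1_quotient alpha (x / gamma alpha t) * gamma alpha t
         else x)%:E].
Proof.
have stau := hitting_time_stopping_time ht hX.
have /andP[_ t1] := ht.
have V : stopping_value P B X t = stopped_mean P X (hitting_time alpha X t).
  apply/eqP; rewrite eq_le; apply/andP; split.
    apply: ge_ereal_sup => _ [tau tau_stop <-].
    rewrite (stopped_mean_hitting_time hB halpha ht hX).
    exact: (stopped_mean_le_value hB halpha ht hX).
  by apply: ereal_sup_ubound; exists (hitting_time alpha X t).
split=> //.
by rewrite V (stopped_mean_hitting_time hB halpha ht hX) candidate_quotient.
Qed.
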